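(* Let $K$ be a field containing $\mathbb{Q}$, let $n\in\mathbb{N}^+$ and let $r=r(n)$ be the number of primes $\le n$. Let $I_n\subseteq K[x_1,\dots,x_r]$ be the monomial ideal generated by all monomials $x_1^{a_1}\cdots x_r^{a_r}$ with $p_1^{a_1}\cdots p_r^{a_r}>n$ (where $p_i$ is the $i$-th prime, $p_1=2$). Then: (I) $\Gamma_n\cong K[x_1,\dots,x_r]/I_n$ as $K$-algebras, and $I_n$ is strongly stable with respect to the reverse order of the variables, i.e. whenever $m$ is a monomial and $x_jm\in I_n$, then $x_im\in I_n$ for all $i$ with $j\le i\le r$. (II) $\Gamma_n$ is artinian with $\dim_K\Gamma_n=n$. Moreover, if $\Gamma_n$ is graded by giving each $\chi_i$ (the image of $x_i$) degree $1$, its Hilbert series is $\sum_i d_i t^i$, where $d_i$ is the number of integers $w$ with $1\le w\le n$ and $\lambda(w)=i$. (III) For each $v$, there is a bijection between the minimal monomial generators $m$ of $I_n$ with $\min(m)=v$ and the tuples $(b_v,\dots,b_r)$ of non-negative integers satisfying $$\log n-\log p_v<\sum_{i=v}^r b_i\log p_i\le \log n.$$ (IV) Writing $C_{n,v}$ for the number of such solutions (equivalently, the number of minimal monomial generators $m$ of $I_n$ with $\min(m)=v$), the Poincaré–Betti series of $K$ over $\Gamma_n$ is $$P(\mathrm{Tor}^{\Gamma_n}_*(K,K),t)=\frac{(1+t)^r}{1-t^2\left(\sum_{i=1}^r(1+t)^{i-1}C_{n,r-i+1}\right)}.$$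
   Context: $\Gamma$ denotes the set of all functions $\mathbb{N}^+\to K$ with pointwise addition and scalar multiplication and the convolution product $(fg)(m)=\sum_{ab=m}f(a)g(b)$. For $n\in\mathbb{N}^+$, $\Gamma_n=\{f\in\Gamma: f(m)=0 \text{ for all } m>n\}$, made into a $K$-algebra with the truncated product $(fg)(m)=\sum_{ab=m}f(a)g(b)$ for $m\le n$ and $(fg)(m)=0$ for $m>n$; equivalently $\Gamma_n\cong\Gamma/J_n$ with $J_n=\{f\in\Gamma: f(m)=0\ \forall m\le n\}$. For $i\ge1$, $\chi_i\in\Gamma$ is the function with $\chi_i(p_i)=1$ and $\chi_i(m)=0$ for $m\ne p_i$. $\lambda:\mathbb{N}^+\to\mathbb{N}$ is given by $\lambda(1)=0$ and $\lambda(q_1\cdots q_l)=l$ for primes $q_1,\dots,q_l$ (not necessarily distinct). For a monomial $m=x_1^{\alpha_1}\cdots x_r^{\alpha_r}$, its support is $\{i:\alpha_i>0\}$ and $\min(m)$ is the smallest element of the support. $\Gamma_n$ is a local ring with residue field $K$, and $P(\mathrm{Tor}^{R}_*(K,K),t)=\sum_{q\ge0}\dim_K\mathrm{Tor}^R_q(K,K)\,t^q$. *)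

(* Defs.v *)
From HB Require Import structures.
From mathcomp Require Import all_boot all_order all_algebra.
From mathcomp Require Import mpoly.
From Stdlib Require Rdefinitions Raxioms Rpower.

Set Implicit Arguments. Unset Strict Implicit. Unset Printing Implicit Defensive.
Import Order.TTheory GRing.Theory.
Local Open Scope ring_scope.

Definition primes_upto (n : nat) : seq nat := [seq p <- iota 2 n.-1 | prime p].
Definition rr (n : nat) : nat := size (primes_upto n).
(* pr n j = p_(j+1), the (j+1)-th prime (0-based index j), meaningful for j < rr n *)
Definition pr (n : nat) (j : nat) : nat := nth 0 (primes_upto n) j.

Definition lambda (w : nat) : nat := (\sum_(p <- primes w) logn p w)%N.

(* Gamma_n: functions on {1..n}; index k : 'I_n stands for the integer k+1. *)
Definition Gam (n : nat) (K : fieldType) := {ffun 'I_n -> K^o}.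

Definition mulG (n : nat) (K : fieldType) (f g : Gam n K) : Gam n K :=
  [ffun m : 'I_n => \sum_(a : 'I_n) \sum_(b : 'I_n | (a.+1 * b.+1 == m.+1)%N)
       (f a : K) * (g b : K)].

Definition oneG (n : nat) (K : fieldType) : Gam n K :=
  [ffun m : 'I_n => ((nat_of_ord m == 0%N)%:R : K)].

Definition chiG (n : nat) (K : fieldType) (j : 'I_(rr n)) : Gam n K :=
  [ffun m : 'I_n => ((m.+1 == pr n j)%:R : K)].

Definition chiprod (n : nat) (K : fieldType) (s : seq 'I_(rr n)) : Gam n K :=
  foldr (fun j acc => mulG (chiG K j) acc) (oneG n K) s.

Definition Gdeg (n : nat) (K : fieldType) (i : nat) : {vspace Gam n K} :=
  <<[seq chiprod K (val t) | t : i.-tuple 'I_(rr n)]>>%VS.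

(* ideals of Gamma_n (every ideal of a K-algebra is a K-subspace) *)
Definition idealG (n : nat) (K : fieldType) (U : {vspace Gam n K}) : Prop :=
  forall a u, u \in U -> mulG a u \in U.

Definition artinianG (n : nat) (K : fieldType) : Prop :=
  forall f : nat -> {vspace Gam n K},
    (forall k, idealG (f k)) -> (forall k, (f k.+1 <= f k)%VS) ->
    exists N, forall k, (N <= k)%N -> f k = f N.

Definition mval (n : nat) (a : 'X_{1..rr n}) : nat :=
  (\prod_(j < rr n) pr n j ^ a j)%N.

Definition inI (n : nat) (K : fieldType) (p : {mpoly K[rr n]}) : Prop :=
  exists s : seq ({mpoly K[rr n]} * 'X_{1..rr n}),
    all (fun x => (n < mval x.2)%N) s /\ p = \sum_(x <- s) x.1 * 'X_[x.2].

Definition minGen (n : nat) (K : fieldType) (m : 'X_{1..rr n}) : Prop :=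
  inI ('X_[m] : {mpoly K[rr n]}) /\
  forall m' : 'X_{1..rr n}, (forall i, (m' i <= m i)%N) -> m' <> m ->
    ~ inI ('X_[m'] : {mpoly K[rr n]}).

Definition minIs (n : nat) (m : 'X_{1..rr n}) (v : 'I_(rr n)) : Prop :=
  (0 < m v)%N /\ forall j : 'I_(rr n), (j < v)%N -> m j = 0%N.

(* tuples (b_v,...,b_r) encoded as exponent vectors b with b_j = 0 for j < v,
   satisfying  log n - log p_v < sum_{i>=v} b_i log p_i <= log n *)
Definition solIneq (n : nat) (v : 'I_(rr n)) (b : 'X_{1..rr n}) : Prop :=
  (forall j : 'I_(rr n), (j < v)%N -> b j = 0%N) /\
  let S := \big[Rdefinitions.Rplus/Rdefinitions.IZR BinNums.Z0]_(j < rr n | (v <= j)%N)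
             Rdefinitions.Rmult (Raxioms.INR (b j)) (Rpower.ln (Raxioms.INR (pr n j))) in
  Rdefinitions.Rlt (Rdefinitions.Rminus (Rpower.ln (Raxioms.INR n))
                                        (Rpower.ln (Raxioms.INR (pr n v)))) S /\
  Rdefinitions.Rle S (Rpower.ln (Raxioms.INR n)).

(* ---------- Tor^R_q(K,K) via the reduced (normalized) bar complex ----------
   For an augmented finite-dimensional K-algebra R = K + m with a basis
   e_0..e_(N-1) of the augmentation ideal m and structure constants
   e_a e_b = sum_k c a b k e_k, Tor^R_q(K,K) is the q-th homology of
   B_q = m^{(x) q} with d(a_1|...|a_q) = sum_{i=1}^{q-1} (-1)^i (a_1|..|a_i a_(i+1)|..|a_q).
   Matrices act on row vectors: dbar q : B_(q+1) -> B_q. *)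
Definition barIdx (N q : nat) := {ffun 'I_q -> 'I_N}.

Definition dbar (K : fieldType) (N : nat) (c : 'I_N -> 'I_N -> 'I_N -> K) (q : nat)
  : 'M[K]_(#|barIdx N q.+1|, #|barIdx N q|) :=
  \matrix_(i, j)
    let s : barIdx N q.+1 := enum_val i in let t : barIdx N q := enum_val j in
    \sum_(l < q)
      (-1) ^+ l.+1 *
      (([forall k : 'I_q, (k < l)%N ==> (t k == s (inord k))] &&
        [forall k : 'I_q, (l < k)%N ==> (t k == s (inord k.+1))])%:R *
       c (s (inord l)) (s (inord l.+1)) (t l)).

Definition dimTor (K : fieldType) (N : nat) (c : 'I_N -> 'I_N -> 'I_N -> K) (q : nat) : nat :=
  (#|barIdx N q| - (if q is q'.+1 then \rank (dbar c q') else 0) - \rank (dbar c q))%N.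

(* structure constants of Gamma_n w.r.t. the basis delta_2,...,delta_n of its
   maximal ideal m = {f | f(1) = 0}; index a : 'I_(n.-1) stands for delta_(a+2),
   i.e. position a+1 in 'I_n *)
Definition deltaG (n : nat) (K : fieldType) (k : nat) : Gam n K :=
  [ffun m : 'I_n => ((nat_of_ord m == k)%:R : K)].

Definition cGam (n : nat) (K : fieldType) (a b k : 'I_(n.-1)) : K :=
  \sum_(m : 'I_n | nat_of_ord m == k.+1) (mulG (deltaG n K a.+1) (deltaG n K b.+1)) m.

Definition TorGam (n : nat) (K : fieldType) (q : nat) : nat := dimTor (@cGam n K) q.

(* Main.v *)
(* Parts (I)-(III) rest on the dictionary x^a <-> p^a between monomials and
   integers, under which I_n is the set of integers > n.

   For (IV), let A_v be the subalgebra of Gamma_n spanned by the integers whose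
   prime factors are all >= p_v, and P_v the Poincare series of K over A_v. Then
   A_(v+1) = A_v / (p_v) is an algebra retract of A_v, and the annihilator of p_v
   in A_v is its socle, spanned by the s with n / p_v < s <= n, because p_v is the
   smallest letter. The retract gives
   P_v = P_(v+1) (1 + t + t^2 C_v P_v), from which the formula follows by
   descending induction on v. This relation is proved directly on bar words: the
   signed shuffle sh(b) of a cycle b over A_(v+1) with the letter p_v is a cycle,
   so is sh(b) | s | z for s in the socle and z a cycle over A_v, and together
   with the cycles over A_(v+1) these span the homology, since a word whose first
   letter divisible by p_v is p_v c, c > 1, is cancelled by the word where that
   letter is split into p_v | c. *)
Require Import Defs.
From HB Require Import structures.
From mathcomp Require Import all_boot all_order all_algebra.
From mathcomp Require Import mpoly ssrAC ring zify.
From mathcomp Require xfinmap monalg.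
From Stdlib Require Classical_Prop Rdefinitions Raxioms RIneq Rpower.

Set Implicit Arguments. Unset Strict Implicit. Unset Printing Implicit Defensive.
Import Order.TTheory GRing.Theory.
Local Open Scope ring_scope.

(** * The free algebra on integer letters *)

(** Linear independence of the proposed homology classes is never addressed directly. A splitting
    records only that [H q], [E q] and the boundaries of [E q.+1] span degree q, and that their
    total number is |A|^q, the number of words. Spanning and counting together force a basis, and
    with it the ranks of the differential. The price is that a complement [E] of the cycles has to
    be carried through the induction beside [H], with a recursion of its own: besides the lifts of
    the old complement it takes the words that split a letter p c, and the products sh(e) | s | w
    with e in the old complement and w an arbitrary word.

    The bar complexes of all the subalgebras live inside one free algebra on the integers.
    Concatenation of bar words is its product, differential and shuffle are linear operators on all
    degrees at once, and passing to a subalgebra only means restricting to the span of words over a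
    smaller alphabet. *)

Module FreeAlgebra.
Import xfinmap monalg.
Section FreeAlgebra.
Variable K : fieldType.

Definition falg : lalgType K := {malg K[{fmonom nat}]}.

Definition wd (w : seq nat) : falg := << FMonom w >>.

Lemma wd_nil : wd [::] = 1.
Proof. by rewrite /wd -fmoneE. Qed.

Lemma wd_cat u v : wd (u ++ v) = wd u * wd v.
Proof.
rewrite /wd; apply/malgP => k.
rewrite [X in _ = X@__](_ : _ = fgmul << FMonom u >> << FMonom v >>); last exact: malgM_def.
by rewrite fgmulUU mulr1 /mmul /= fmmulE.
Qed.

Lemma falg_sum (x : falg) :
  x = \sum_(k <- msupp x) mcoeff k x *: wd (fmonom_val k).
Proof.
rewrite [LHS]monalgE; apply: eq_bigr => k _.
by apply/malgP => k'; rewrite mcoeffZ !mcoeffU fmK; case: eqP; rewrite ?mulr1 ?mulr0.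
Qed.

Lemma falg_ind (P : falg -> Prop) :
  P 0 -> (forall c w x, P x -> P (c *: wd w + x)) -> forall x, P x.
Proof.
move=> P0 PS x; rewrite (falg_sum x).
elim: (msupp x : seq _) => [|k s IH]; first by rewrite big_nil.
by rewrite big_cons; apply: PS.
Qed.

Lemma falg_scalerAr (c : K) (x y : {malg K[{fmonom nat}]}) :
  c *: (x * y) = x * (c *: y).
Proof.
apply/malgP => k; rewrite mcoeffZ mcoeffMl.
rewrite (mcoeffMlw (d1 := msupp x) (d2 := msupp y)) ?msuppZ_le ?fsubset_refl //.
rewrite mulr_sumr; apply: eq_bigr => k1 _; rewrite mulr_sumr; apply: eq_bigr => k2 _.
by rewrite mcoeffZ mulrCA -!mulrnAr.
Qed.

Section Lext.
Variables (V : lmodType K) (f : seq nat -> V).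
Definition lext_fun (x : falg) : V := \sum_(k <- msupp x) mcoeff k x *: f (fmonom_val k).

Lemma lext_funEw (d : {fset fmonom nat}) (x : falg) : fsubset (msupp x) d ->
  lext_fun x = \sum_(k <- d) mcoeff k x *: f (fmonom_val k).
Proof.
move=> le; rewrite [LHS](big_fset_incl _ le) => //= y yd /mcoeff_outdom ->.
by rewrite scale0r.
Qed.

Lemma lext_fun_linear : linear lext_fun.
Proof.
move=> c x y.
pose d := fsetU (msupp x) (fsetU (msupp y) (msupp (c *: x + y))).
rewrite !(@lext_funEw d) ?fsubsetUl //.
- rewrite scaler_sumr -big_split /=; apply: eq_bigr => k _.
  by rewrite mcoeffD mcoeffZ scalerDl scalerA.
- by apply: fsubset_trans (fsubsetUr _ _); apply: fsubsetUl.
- by apply: fsubset_trans (fsubsetUr _ _); apply: fsubsetUr.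
Qed.

HB.instance Definition _ := GRing.isLinear.Build K falg V *:%R lext_fun lext_fun_linear.

Definition lext : {linear falg -> V} := lext_fun.

Lemma lextE w : lext (wd w) = f w.
Proof.
by rewrite /= (lext_funEw msuppU_le) big_seq_fset1 mcoeffUU scale1r.
Qed.
End Lext.
End FreeAlgebra.
End FreeAlgebra.

(* Wrapping the construction in an opaque record keeps unification from
   unfolding it. *)
Record free_algebra (K : fieldType) := FreeAlg {
  falg :> lalgType K;
  falg_wd : seq nat -> falg;
  falg_wd_nil : falg_wd [::] = 1;
  falg_wd_cat : forall u v, falg_wd (u ++ v) = falg_wd u * falg_wd v;
  falg_ind : forall P : falg -> Prop, P 0 ->
    (forall c w x, P x -> P (c *: falg_wd w + x)) -> forall x, P x;
  falg_mulrZ : forall (c : K) (x y : falg), x * (c *: y) = c *: (x * y);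
  falg_lext : forall V : lmodType K, (seq nat -> V) -> {linear falg -> V};
  falg_lextE : forall (V : lmodType K) (f : seq nat -> V) w,
    falg_lext f (falg_wd w) = f w }.

Lemma free_algebra_exists (K : fieldType) : free_algebra K.
Proof.
exact: (@FreeAlg K (FreeAlgebra.falg K) (@FreeAlgebra.wd K) (FreeAlgebra.wd_nil K)
  (@FreeAlgebra.wd_cat K) (@FreeAlgebra.falg_ind K)
  (fun c x y => esym (@FreeAlgebra.falg_scalerAr K c x y))
  (@FreeAlgebra.lext K) (@FreeAlgebra.lextE K)).
Qed.

Arguments falg_lext {K F V} f : rename.
Arguments falg_lextE {K F V} f w : rename.
Arguments falg_wd_nil {K} F : rename.

(** * Bar words and their differential *)

Section Span.
Variables (K : fieldType) (V : lmodType K).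

(** An inductive predicate, because the ambient free algebra is infinite-dimensional and many
    spanning families are given by a property rather than a list. *)
Inductive lspan (S : V -> Prop) : V -> Prop :=
| lspan0 : lspan S 0
| lspanS c s x : S s -> lspan S x -> lspan S (c *: s + x).

Lemma lspan_in (S : V -> Prop) x : S x -> lspan S x.
Proof.
by move=> Sx; rewrite -[x]addr0 -[x]scale1r; apply: lspanS => //; apply: lspan0.
Qed.

Lemma lspanD S x y : lspan S x -> lspan S y -> lspan S (x + y).
Proof.
move=> + Sy; elim=> [|c s {}x Ss _ IH]; first by rewrite add0r.
by rewrite -addrA; apply: lspanS.
Qed.

Lemma lspanZ S a x : lspan S x -> lspan S (a *: x).
Proof.
elim=> [|c s {}x Ss _ IH]; first by rewrite scaler0; apply: lspan0.
by rewrite scalerDr scalerA; apply: lspanS.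
Qed.

Lemma lspanN S x : lspan S x -> lspan S (- x).
Proof. by move=> Sx; rewrite -scaleN1r; apply: lspanZ. Qed.

Lemma lspanB S x y : lspan S x -> lspan S y -> lspan S (x - y).
Proof. by move=> Sx Sy; apply: lspanD => //; apply: lspanN. Qed.

Lemma lspan_sum S I (r : seq I) (P : pred I) (f : I -> V) :
  (forall i, P i -> lspan S (f i)) -> lspan S (\sum_(i <- r | P i) f i).
Proof. by move=> Sf; elim/big_ind: _ => //; [exact: lspan0 | exact: lspanD]. Qed.
End Span.

Lemma lspan_lin (K : fieldType) (V W : lmodType K) (f : {linear V -> W})
    (S : V -> Prop) (S' : W -> Prop) x :
  lspan S x -> (forall s, S s -> lspan S' (f s)) -> lspan S' (f x).
Proof.
move=> Sx Sf; elim: Sx => [|c s {}x Ss _ IH]; first by rewrite linear0; apply: lspan0.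
by rewrite linearP; apply: lspanD => //; apply: lspanZ; apply: Sf.
Qed.

Lemma lspan_trans (K : fieldType) (V : lmodType K) (S S' : V -> Prop) x :
  lspan S x -> (forall s, S s -> lspan S' s) -> lspan S' x.
Proof. exact: (lspan_lin (f := idfun)). Qed.

Fixpoint words (A : seq nat) (q : nat) : seq (seq nat) :=
  if q is q'.+1 then [seq a :: w | a <- A, w <- words A q'] else [:: [::]].

Lemma size_words A q : size (words A q) = (size A ^ q)%N.
Proof. by elim: q => //= q IH; rewrite size_allpairs IH expnS. Qed.

Lemma mem_words A q w : (w \in words A q) = (size w == q) && all (mem A) w.
Proof.
elim: q w => [|q IH] [|a w] //=.
  by apply/negP => /allpairsP [[b v] /= []].
apply/allpairsP/idP => [[[b v] /= [Ab vq [-> ->]]]|/andP [sw /andP [Aa Aw]]].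
  by move: vq; rewrite IH eqSS => /andP [-> ->]; rewrite Ab.
by exists (a, w); split=> //=; rewrite IH -eqSS sw Aw.
Qed.

Section Bar.
Variables (K : fieldType) (F : free_algebra K) (n : nat).
Local Notation wd := (@falg_wd K F).
Local Notation ltr a := (wd [:: a]).

Lemma wd_cons a w : wd (a :: w) = ltr a * wd w.
Proof. by rewrite -cat1s falg_wd_cat. Qed.

(* The test [0 < a * b] keeps [mu] associative in presence of the junk letter 0. *)
Definition mu_word a (w : seq nat) : F :=
  if w is b :: w' then if (0 < a * b <= n)%N then wd ((a * b)%N :: w') else 0 else 0.

Definition mu a : {linear F -> F} := falg_lext (mu_word a).

(** Either the first two letters merge, or the merge happens in the tail, where positions are
    shifted by one and every sign changes. *)
Fixpoint bd_word (w : seq nat) : F :=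
  if w is a :: w' then mu a (wd w') - ltr a * bd_word w' else 0.

(* Minus the differential of the reduced bar complex. *)
Definition bd : {linear F -> F} := falg_lext bd_word.

Lemma mu_nil a : mu a 1 = 0.
Proof. by rewrite -(falg_wd_nil F) falg_lextE. Qed.

Lemma mu_cons a b x : mu a (ltr b * x) = if (0 < a * b <= n)%N then ltr (a * b)%N * x else 0.
Proof.
elim/(@falg_ind K F): x => [|c w x IH]; first by rewrite !mulr0 linear0; case: ifP.
rewrite !mulrDr linearD IH !falg_mulrZ linearZ -!wd_cons falg_lextE /=.
by case: ifP; rewrite ?scaler0 ?addr0.
Qed.

Lemma bd_nil : bd 1 = 0.
Proof. by rewrite -(falg_wd_nil F) falg_lextE. Qed.

Lemma bd_cons a x : bd (ltr a * x) = mu a x - ltr a * bd x.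
Proof.
elim/(@falg_ind K F): x => [|c w x IH].
  by rewrite !mulr0 !linear0 mulr0 subr0.
rewrite !mulrDr !linearD IH !linearZ /= !falg_mulrZ linearZ -wd_cons mulrDr falg_mulrZ.
by rewrite !(falg_lextE bd_word) /= scalerBr opprD addrACA.
Qed.

Lemma mu_mu a b x : mu a (mu b x) = if (0 < a * b <= n)%N then mu (a * b)%N x else 0.
Proof.
elim/(@falg_ind K F): x => [|c w x IH]; first by rewrite !linear0; case: ifP.
rewrite !linearD IH !linearZ /=.
suff -> : mu a (mu b (wd w)) = if (0 < a * b <= n)%N then mu (a * b)%N (wd w) else 0.
  by case: ifP; rewrite ?scaler0 ?addr0.
case: w => [|d w]; first by rewrite (falg_wd_nil F) !mu_nil linear0; case: ifP.
rewrite wd_cons !mu_cons; case: (boolP (0 < b * d <= n)%N) => [bd_n|bd_n].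
  rewrite mu_cons mulnA; case: (boolP (0 < a * b <= n)%N) => [//|ab_n].
  case: ifP => // abd_n; case/negP: ab_n.
  case/andP: abd_n; rewrite !muln_gt0 -andbA => /and3P [-> -> d0] /=.
  by apply: leq_trans; rewrite leq_pmulr.
rewrite linear0; case: (boolP (0 < a * b <= n)%N) => [ab_n|//].
case: ifP => // abd_n; case/negP: bd_n.
case/andP: abd_n; rewrite !muln_gt0 -andbA => /and3P [a0 -> ->] /=.
by apply: leq_trans; rewrite -mulnA leq_pmull.
Qed.

(** Only the merge of the first two letters involves the multiplier [a], and there associativity
    applies: multiplying the first letter is a chain map. *)
Lemma bd_mu a x : bd (mu a x) = mu a (bd x).
Proof.
elim/(@falg_ind K F): x => [|c w x IH]; first by rewrite !linear0.
rewrite !linearD IH !linearZ /=; congr (_ *: _ + _).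
case: w => [|b w]; first by rewrite (falg_wd_nil F) mu_nil bd_nil !linear0.
rewrite wd_cons mu_cons bd_cons linearB /= mu_mu mu_cons.
by case: ifP => _; rewrite ?bd_cons // linear0 subr0.
Qed.

Lemma bd_bd x : bd (bd x) = 0.
Proof.
elim/(@falg_ind K F): x => [|c w x IH]; first by rewrite !linear0.
rewrite !linearD IH !linearZ addr0 /=; suff -> : bd (bd (wd w)) = 0 by rewrite scaler0.
elim: w {c x IH} => [|a w IH]; first by rewrite (falg_wd_nil F) bd_nil linear0.
by rewrite wd_cons bd_cons linearB /= bd_cons bd_mu IH mulr0 subr0 subrr.
Qed.

Section Shuffle.
Variable p : nat.

Definition sh_word (w : seq nat) : F :=
  \sum_(i < (size w).+1) (-1) ^+ i *: wd (take i w ++ p :: drop i w).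

(* Signed shuffle product with the letter [p]. *)
Definition sh : {linear F -> F} := falg_lext sh_word.

Lemma sh_nil : sh 1 = ltr p.
Proof.
rewrite -(falg_wd_nil F) falg_lextE /sh_word big_ord_recl big_ord0 /=.
by rewrite scale1r addr0.
Qed.

Lemma sh_cons b x : sh (ltr b * x) = ltr p * ltr b * x - ltr b * sh x.
Proof.
elim/(@falg_ind K F): x => [|c w x IH]; first by rewrite !mulr0 !linear0 mulr0 subrr.
rewrite !mulrDr !linearD IH !linearZ /= !falg_mulrZ linearZ -wd_cons mulrDr falg_mulrZ.
rewrite !falg_lextE {1}/sh_word big_ord_recl /= expr0 scale1r opprD addrACA.
congr (_ + _); rewrite -scalerBr; congr (_ *: _).
rewrite (wd_cons p) (wd_cons b w) mulrA; congr (_ + _).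
rewrite /sh_word mulr_sumr -sumrN; apply: eq_bigr => i _.
by rewrite falg_mulrZ -wd_cons /= exprS mulN1r scaleNr.
Qed.

(* The shuffle product is a chain map because the algebra is commutative. *)
Lemma bd_sh x : bd (sh x) = - sh (bd x).
Proof.
elim/(@falg_ind K F): x => [|c w x IH]; first by rewrite !linear0.
rewrite !linearD IH !linearZ /=; congr (_ *: _ + _).
elim: w {c x IH} => [|b w IH].
  rewrite (falg_wd_nil F) sh_nil bd_nil linear0 oppr0 -[ltr p]mulr1 bd_cons bd_nil.
  by rewrite mu_nil mulr0 subrr.
rewrite wd_cons sh_cons bd_cons !linearB /= -mulrA !bd_cons IH sh_cons.
rewrite mu_cons mulrBr !mulrA !mulrN.
(* Commutativity enters here: p just before b and p just after b merge to the same letter, with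
   opposite signs. *)
suff -> : mu b (sh (wd w)) = (if (0 < p * b <= n)%N then ltr (p * b)%N * wd w else 0)
    - ltr p * mu b (wd w) + sh (mu b (wd w)).
  set A := (if _ then _ else _); set B := ltr p * _; set C := ltr p * _ * _.
  set D := sh _; set E := ltr b * _.
  rewrite !opprB !opprD !opprK.
  rewrite !addrA [LHS](ACl ((1*5)*(3*6)*(7*(2*4)))) /=.
  by rewrite subrr addNr !add0r !addrA.
case: w {IH} => [|c w].
  rewrite (falg_wd_nil F) sh_nil mu_nil mulr0 !linear0 !addr0 -[ltr p]mulr1 mu_cons.
  by rewrite [(b * p)%N]mulnC.
rewrite wd_cons sh_cons linearB /= -mulrA !mu_cons [(b * p)%N]mulnC -addrA; congr (_ + _).
case: ifP => _; last by rewrite mulr0 !linear0 addr0.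
by rewrite sh_cons mulrA addrA addNr add0r.
Qed.
End Shuffle.

Definition W (A : seq nat) q (x : F) := exists2 w, w \in words A q & x = wd w.

Lemma lspan_mul (S S' S'' : F -> Prop) x y : lspan S x -> lspan S' y ->
  (forall s s', S s -> S' s' -> lspan S'' (s * s')) -> lspan S'' (x * y).
Proof.
move=> Sx Sy SS; elim: Sx => [|c s {}x Ss _ IH]; first by rewrite mul0r; apply: lspan0.
rewrite mulrDl -scalerAl; apply: lspanD => //; apply: lspanZ.
elim: Sy {IH} => [|d t {}y St _ IHy]; first by rewrite mulr0; apply: lspan0.
by rewrite mulrDr falg_mulrZ; apply: lspanD => //; apply: lspanZ; apply: SS.
Qed.

Lemma W_mul A i j x y : W A i x -> W A j y -> W A (i + j) (x * y).
Proof.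
move=> [u uA ->] [v vA ->]; exists (u ++ v); last by rewrite falg_wd_cat.
move: uA vA; rewrite !mem_words size_cat all_cat => /andP [/eqP -> ->] /andP [/eqP -> ->].
by rewrite eqxx.
Qed.

Lemma lspanW_mul A i j x y :
  lspan (W A i) x -> lspan (W A j) y -> lspan (W A (i + j)) (x * y).
Proof. by move=> Wx Wy; apply: lspan_mul Wx Wy _ => *; apply/lspan_in/W_mul. Qed.

Lemma W_ltr (A : seq nat) a : a \in A -> W A 1 (ltr a).
Proof. by move=> Aa; exists [:: a]; rewrite ?mem_words //= Aa. Qed.

Lemma W0 A : W A 0 1.
Proof. by exists [::]; rewrite ?(falg_wd_nil F). Qed.

Lemma W0P A x : W A 0 x -> x = 1.
Proof. by move=> [w]; rewrite inE => /eqP -> ->; rewrite (falg_wd_nil F). Qed.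

Lemma WSP A q x : W A q.+1 x ->
  exists a y, [/\ a \in A, W A q y & x = ltr a * y].
Proof.
move=> [w]; rewrite mem_words; case: w => [//|a w] /= /andP [sw /andP [Aa Aw]] ->.
exists a, (wd w); split=> //; last by rewrite wd_cons.
by exists w => //; rewrite mem_words -eqSS sw.
Qed.

Lemma W_sub A A' q x : {subset A' <= A} -> W A' q x -> W A q x.
Proof.
move=> sA [w + ->]; rewrite mem_words => /andP [sw Aw]; exists w => //.
by rewrite mem_words sw; apply: sub_all Aw.
Qed.

Lemma lspanW_sub A A' q x : {subset A' <= A} -> lspan (W A' q) x -> lspan (W A q) x.
Proof. by move=> sA Wx; apply: lspan_trans Wx _ => s Ws; apply/lspan_in/(W_sub sA Ws). Qed.

(** Together with 1, such an alphabet of integers at most n spans a subalgebra of Gamma_n. *)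
Definition mul_closed (A : seq nat) :=
  forall a b, a \in A -> b \in A -> (a * b <= n)%N -> (a * b)%N \in A.

Lemma mu_W A q a x : mul_closed A -> a \in A -> lspan (W A q) x ->
  lspan (W A q) (mu a x).
Proof.
move=> cA Aa Wx; apply: lspan_lin Wx _ => {}x.
case: q => [/W0P ->|q /WSP [b [y [Ab Wy ->]]]]; first by rewrite mu_nil; apply: lspan0.
rewrite mu_cons; case: ifP => [/andP [_ ab]|_]; last exact: lspan0.
by apply: lspan_in; rewrite -add1n; apply: W_mul => //; apply: W_ltr; apply: cA.
Qed.

Lemma bd_W A q x : mul_closed A -> lspan (W A q) x -> lspan (W A q.-1) (bd x).
Proof.
move=> cA Wx; apply: lspan_lin Wx _ => {}x.
elim: q x => [|q IH] x; first by move/W0P->; rewrite bd_nil; apply: lspan0.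
case/WSP=> a [y [Aa Wy ->]]; rewrite bd_cons; apply: lspanB.
  by apply: mu_W => //; apply: lspan_in.
case: q IH Wy => [_ /W0P -> | q IH Wy]; first by rewrite bd_nil mulr0; apply: lspan0.
by rewrite /= -add1n; apply: lspanW_mul; [apply/lspan_in/W_ltr | apply: IH].
Qed.

Lemma bd_W0 A x : lspan (W A 0) x -> bd x = 0.
Proof.
by elim=> [|c s {}x /W0P -> _ IH]; rewrite ?linear0 // linearP IH bd_nil scaler0 addr0.
Qed.

Lemma sh_W A p q x : p \in A -> lspan (W A q) x -> lspan (W A q.+1) (sh p x).
Proof.
move=> Ap Wx; apply: lspan_lin Wx _ => _ [w + ->].
rewrite mem_words => /andP [/eqP sw Aw]; rewrite falg_lextE; apply: lspan_sum => -[i /= _] _.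
apply/lspanZ/lspan_in; exists (take i w ++ p :: drop i w) => //.
rewrite mem_words size_cat /= addnS -size_cat cat_take_drop sw eqxx all_cat /= Ap /=.
by rewrite -all_cat cat_take_drop.
Qed.

Lemma mu_socle A q s x : (forall a, a \in A -> (n < a * s)%N) ->
  lspan (W A q) x -> mu s x = 0.
Proof.
move=> sA; elim=> [|c y {}x Wy _ IH]; first by rewrite linear0.
rewrite linearP IH addr0; case: q Wy {x IH} => [/W0P ->|q /WSP [b [z [Ab _ ->]]]].
  by rewrite mu_nil scaler0.
by rewrite mu_cons mulnC [(_ <= n)%N]leqNgt sA // andbF scaler0.
Qed.

Lemma mu_mul_socle A q s a x z : (forall a, a \in A -> (n < a * s)%N) -> a \in A ->
  W A q x -> mu a (x * (ltr s * z)) = mu a x * (ltr s * z).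
Proof.
move=> sA Aa; case: q => [/W0P ->|q /WSP [b [y [Ab _ ->]]]].
  by rewrite mul1r mu_nil mul0r mu_cons [(_ <= n)%N]leqNgt sA // andbF.
by rewrite -mulrA !mu_cons; case: ifP => _; rewrite ?mul0r ?mulrA.
Qed.

(** A socle letter [s] merges to 0 with either neighbour, so the differential acts on [u] and [z]
    separately. The sign of the second term counts the m letters of [u] and [s] itself. *)
Lemma bd_mul_socle A m j s u z : (forall a, a \in A -> (n < a * s)%N) ->
  lspan (W A m) u -> lspan (W A j) z ->
  bd (u * (ltr s * z)) = bd u * (ltr s * z) - (-1) ^+ m *: (u * (ltr s * bd z)).
Proof.
move=> sA Wu Wz; elim: Wu => [|c y {}u Wy _ IH].
  by rewrite !(linear0, mul0r, scaler0, subr0).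
rewrite mulrDl -scalerAl linearP /= IH linearP /= !mulrDl -!scalerAl scalerDr.
rewrite opprD addrACA; congr (_ + _).
rewrite scalerA [_ * c]mulrC -scalerA -scalerBr; congr (_ *: _).
elim: m y Wy {c u IH} => [|m IH] y.
  move/W0P->; rewrite !mul1r bd_nil mul0r bd_cons expr0 scale1r.
  by rewrite (mu_socle sA Wz) sub0r.
case/WSP=> a [x [Aa Wx ->]]; rewrite -mulrA !bd_cons IH // (mu_mul_socle _ sA Aa Wx).
rewrite mulrBl mulrBr opprB !mulrA falg_mulrZ exprS mulN1r scaleNr opprK.
by rewrite !mulrA -addrA; congr (_ + _); rewrite addrC.
Qed.

Definition mem_of (s : seq F) (x : F) : Prop := x \in s.

(* [H q] lists cycles representing a homology basis in degree [q], and [E q]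
   lists a basis of a complement of the cycles. *)
Definition bar_splitting (A : seq nat) (H E : nat -> seq F) :=
  [/\ forall q x, x \in H q -> lspan (W A q) x /\ bd x = 0,
      forall q x, x \in E q -> lspan (W A q) x,
      forall q x, W A q x -> lspan (mem_of (H q ++ E q ++ map bd (E q.+1))) x,
      forall q, (size (H q) + size (E q) + size (E q.+1) = size A ^ q)%N &
      E 0%N = [::] ].

(** The shift makes [cv f g q.-1] the coefficient of t^q in t^2 f(t) g(t), with an empty sum for q =
    0 and q = 1: the letters p and s use up two degrees. [convl] is the same convolution for
    lists. *)
Definition cv (f g : nat -> nat) m := (\sum_(i < m) f i * g (m.-1 - i))%N.

Definition convl (f : nat -> nat -> seq F) m :=
  flatten [seq f i (m.-1 - i)%N | i <- iota 0 m].

Lemma size_convl f (g h : nat -> nat) m :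
  (forall i j, size (f i j) = (g i * h j)%N) -> size (convl f m) = cv g h m.
Proof.
move=> sf; rewrite size_flatten /shape -map_comp sumnE big_map.
rewrite -[X in iota 0 X]subn0 big_mkord.
by apply: eq_bigr => i _; rewrite /= sf.
Qed.

Lemma mem_convl f m i j x : (i + j).+1 = m -> x \in f i j -> x \in convl f m.
Proof.
move=> <- fx; apply/flatten_mapP; exists i; first by rewrite mem_iota /= add0n ltnS leq_addr.
by rewrite /= addKn.
Qed.

Lemma convlP f m x : x \in convl f m ->
  exists i j, (i + j).+1 = m /\ x \in f i j.
Proof.
case/flatten_mapP => i; rewrite mem_iota add0n /= => im fx.
by exists i, (m.-1 - i)%N; split=> //; case: m im fx => // m; rewrite ltnS => /subnKC ->.
Qed.

Definition sft (f : nat -> seq F) q := if q is q'.+1 then f q' else [::].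

(** * Adjoining the smallest prime *)

Section Step.
(** The letters of [A] are partitioned twice: into those that p kills ([Sc]) and those that it does
    not ([Cc]), and, in the intended case, into those prime to p ([A']) and the multiples of p,
    which are p and the p c with c in [Cc]. *)
Variables (p : nat) (A A' Sc Cc : seq nat).
Hypothesis A_split : perm_eq A (Sc ++ Cc).
Hypothesis A_split_p : perm_eq A (A' ++ p :: map (muln p) Cc).
Hypothesis clA : mul_closed A.
Hypothesis clA' : mul_closed A'.
Hypothesis socle : forall s a, s \in Sc -> a \in A -> (n < a * s)%N.
Hypothesis Cc_le : forall c, c \in Cc -> (0 < p * c <= n)%N.

Variables (H' E' : nat -> seq F).
Hypothesis split' : bar_splitting A' H' E'.

Let sA' : {subset A' <= A}.
Proof. by move=> a aA'; rewrite (perm_mem A_split_p) mem_cat aA'. Qed.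
Let Ap : p \in A.
Proof. by rewrite (perm_mem A_split_p) mem_cat inE eqxx orbT. Qed.
Let sSc : {subset Sc <= A}.
Proof. by move=> a aS; rewrite (perm_mem A_split) mem_cat aS. Qed.
Let sCc : {subset Cc <= A}.
Proof. by move=> a aS; rewrite (perm_mem A_split) mem_cat aS orbT. Qed.

Local Notation sh := (sh p).

Definition sprod (X : seq F) (Y : seq F) :=
  [seq u * y | u <- [seq sh h * ltr s | h <- X, s <- Sc], y <- Y].

Lemma size_sprod X Y : size (sprod X Y) = (size Sc * (size X * size Y))%N.
Proof. by rewrite !size_allpairs mulnA [(size Sc * size X)%N]mulnC. Qed.

Lemma mem_sprod X Y x s y : x \in X -> s \in Sc -> y \in Y ->
  sh x * (ltr s * y) \in sprod X Y.
Proof.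
move=> Xx Ss Yy; rewrite mulrA; apply: (allpairs_f (fun u y => u * y)) => //.
exact: (allpairs_f (fun h s => sh h * ltr s)).
Qed.

Lemma sprodP X Y z : z \in sprod X Y ->
  exists x s y, [/\ x \in X, s \in Sc, y \in Y & z = sh x * (ltr s * y)].
Proof.
case/allpairsP => -[u y] /= [/allpairsP [[x s] /= [Xx Ss ->]] Yy ->].
by exists x, s, y; rewrite mulrA.
Qed.

(** The boundary of b | p | c | r has the leading term b | p c | r, so these words pair off with the
    words whose first letter outside [A'] is some p c. *)
Definition Dl i j : seq F :=
  [seq wd (u ++ r) | u <- [seq b ++ [:: p; c] | b <- words A' i, c <- Cc],
                     r <- words A j].

Definition Hnext (H : nat -> seq F) q :=
  H' q ++ sft (fun i => map sh (H' i)) q ++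
  convl (fun i j => sprod (H' i) (H j)) q.-1.

(** In a product sh(x) | s | y with x in [H'], the first factor is a cycle and y must come from [E].
    With x in [E'], the pair x, bd x is contractible whatever follows, so every word is allowed as
    y. *)
Definition Enext (E : nat -> seq F) q :=
  E' q ++ sft (fun i => map sh (E' i)) q ++ convl Dl q.-1 ++
  convl (fun i j => sprod (E' i) (map wd (words A j))) q.-1 ++
  convl (fun i j => sprod (H' i) (E j)) q.-1.

Lemma convl_ext (f g : nat -> nat -> seq F) q :
  (forall i j, (j < q)%N -> f i j = g i j) -> convl f q.-1 = convl g q.-1.
Proof.
move=> fg; congr flatten; apply/eq_in_map => i; rewrite mem_iota add0n => /andP [_ iq].
by apply: fg; case: q iq => [|[|q]] //= iq; rewrite ltnS (leq_trans (leq_subr _ _)).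
Qed.

(** Course-of-values recursion: degree q depends only on lower degrees, so its value is stable from
    iteration q + 1 on. *)
Lemma exists_fixpoint (N : (nat -> seq F) -> nat -> seq F) :
  (forall f g q, (forall j, (j < q)%N -> f j = g j) -> N f q = N g q) ->
  exists f, forall q, f q = N f q.
Proof.
move=> ext; pose G m := iter m N (fun _ => [::]).
have stab m : forall q m', (q < m)%N -> (q < m')%N -> G m q = G m' q.
  elim: m => [//|m IH] q [//|m'] qm qm'; rewrite /G !iterS; apply: ext => j jq.
  by apply: IH; apply: leq_trans jq _.
exists (fun q => G q.+1 q) => q; rewrite [LHS]/G iterS; apply: ext => j jq.
exact: stab.
Qed.

Variables (H E : nat -> seq F).
Hypothesis H_eq : forall q, H q = Hnext H q.
Hypothesis E_eq : forall q, E q = Enext E q.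

Let E0 : E 0%N = [::].
Proof. by rewrite E_eq /Enext; case: split' => _ _ _ _ ->. Qed.

Lemma in_H_sub q x : x \in H' q -> x \in H q.
Proof. by rewrite H_eq mem_cat => ->. Qed.
Lemma in_H_sh q x : x \in H' q -> sh x \in H q.+1.
Proof. by move=> xH; rewrite H_eq !mem_cat (map_f sh xH) orbT. Qed.
Lemma in_H_convl q x : x \in convl (fun i j => sprod (H' i) (H j)) q.-1 -> x \in H q.
Proof. by rewrite H_eq !mem_cat => ->; rewrite !orbT. Qed.
Lemma in_E_convl q x :
  [|| x \in convl Dl q.-1,
      x \in convl (fun i j => sprod (E' i) (map wd (words A j))) q.-1
    | x \in convl (fun i j => sprod (H' i) (E j)) q.-1] -> x \in E q.
Proof. by rewrite E_eq !mem_cat => ->; rewrite !orbT. Qed.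
Lemma in_H_sprod i j s x y : x \in H' i -> s \in Sc -> y \in H j ->
  sh x * (ltr s * y) \in H (i + j).+2.
Proof.
move=> xH sS yH; apply: in_H_convl.
exact: (mem_convl (f := fun i j => sprod (H' i) (H j)) (erefl (i + j).+1)
  (mem_sprod xH sS yH)).
Qed.
Lemma in_E_sub q x : x \in E' q -> x \in E q.
Proof. by rewrite E_eq mem_cat => ->. Qed.
Lemma in_E_sh q x : x \in E' q -> sh x \in E q.+1.
Proof. by move=> xE; rewrite E_eq !mem_cat (map_f sh xE) orbT. Qed.
Lemma in_E_D i j b c r : b \in words A' i -> c \in Cc -> r \in words A j ->
  wd (b ++ p :: c :: r) \in E (i + j).+2.
Proof.
move=> bA cC rA; apply/in_E_convl/or3P/Or31.
apply: (mem_convl (erefl (i + j).+1)).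
rewrite -[p :: _]/([:: p; c] ++ r) catA.
apply: (allpairs_f (fun u r => wd (u ++ r))) => //.
exact: (allpairs_f (fun b c => b ++ [:: p; c])).
Qed.
Lemma in_E_sprod_word i j s x w : x \in E' i -> s \in Sc -> w \in words A j ->
  sh x * (ltr s * wd w) \in E (i + j).+2.
Proof.
move=> xE sS wA; apply/in_E_convl/or3P/Or32.
exact: (mem_convl (f := fun i j => sprod (E' i) (map wd (words A j)))
  (erefl (i + j).+1) (mem_sprod xE sS (map_f wd wA))).
Qed.
Lemma in_E_sprod i j s x y : x \in H' i -> s \in Sc -> y \in E j ->
  sh x * (ltr s * y) \in E (i + j).+2.
Proof.
move=> xH sS yE; apply/in_E_convl/or3P/Or33.
exact: (mem_convl (f := fun i j => sprod (H' i) (E j)) (erefl (i + j).+1)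
  (mem_sprod xH sS yE)).
Qed.

Lemma lspanW_sprod i j s x y : s \in Sc ->
  lspan (W A' i) x -> lspan (W A j) y -> lspan (W A (i + j).+2) (sh x * (ltr s * y)).
Proof.
move=> sS Wx Wy; rewrite -addSn -addnS -add1n; apply: lspanW_mul.
  by rewrite add1n; apply: sh_W => //; apply: lspanW_sub Wx.
by rewrite -[j.+1]add1n; apply: lspanW_mul => //; apply/lspan_in/W_ltr/sSc.
Qed.

Lemma H_cycles q x : x \in H q -> lspan (W A q) x /\ bd x = 0.
Proof.
have [sH' _ _ _ _] := split'.
elim/ltn_ind: q x => q IH x; rewrite H_eq !mem_cat => /or3P [].
- by move=> /sH' [Wx ->]; split=> //; apply: lspanW_sub Wx.
- case: q {IH} => [//|q] /mapP [y /sH' [Wy dy] ->]; split.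
    by apply: sh_W => //; apply: lspanW_sub Wy.
  by rewrite bd_sh dy linear0 oppr0.
- case/convlP=> i [j [ij /sprodP [y [s [z [/sH' [Wy dy] sS zH ->]]]]]].
  have ijq : (i + j).+2 = q by case: q ij {IH} => [|[|q]] //= [->].
  have [Wz dz] : lspan (W A j) z /\ bd z = 0.
    by apply: IH zH; rewrite -ijq ltnS leqW ?leq_addl.
  split; first by rewrite -ijq; apply: lspanW_sprod.
  have Wsy : lspan (W A i.+1) (sh y) by apply: sh_W => //; apply: lspanW_sub Wy.
  rewrite (bd_mul_socle (fun a => socle sS) Wsy Wz).
  by rewrite bd_sh dy dz linear0 oppr0 mul0r !mulr0 scaler0 subrr.
Qed.

Lemma E_words q x : x \in E q -> lspan (W A q) x.
Proof.
have [sH' sE' _ _ _] := split'.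
elim/ltn_ind: q x => q IH x; rewrite E_eq !mem_cat => /orP [|/or4P []].
- by move=> /sE' Wx; apply: lspanW_sub Wx.
- case: q {IH} => [//|q] /mapP [y /sE' Wy ->].
  by apply: sh_W => //; apply: lspanW_sub Wy.
- case/convlP=> i [j [ij /allpairsP [[u r] /= [/allpairsP [[b c] /= [bA cC ->]] rA ->]]]].
  have ijq : (i + j).+2 = q by case: q ij {IH} => [|[|q]] //= [->].
  apply: lspan_in; exists ((b ++ [:: p; c]) ++ r) => //.
  move: bA rA; rewrite !mem_words !size_cat !all_cat /= Ap sCc //=.
  move=> /andP [/eqP -> bA] /andP [/eqP -> ->].
  by rewrite addn2 !addSn ijq eqxx !andbT; apply: sub_all bA => a /sA'.
- case/convlP=> i [j [ij /sprodP [y [s [z [/sE' Wy sS /mapP [w wA ->] ->]]]]]].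
  have <- : (i + j).+2 = q by case: q ij {IH} => [|[|q]] //= [->].
  by apply: lspanW_sprod => //; apply: lspan_in; exists w.
- case/convlP=> i [j [ij /sprodP [y [s [z [/sH' [Wy _] sS zE ->]]]]]].
  have ijq : (i + j).+2 = q by case: q ij {IH} => [|[|q]] //= [->].
  rewrite -ijq; apply: lspanW_sprod => //; apply: IH zE.
  by rewrite -ijq ltnS leqW ?leq_addl.
Qed.

Local Notation G q := (mem_of (H q ++ E q ++ map bd (E q.+1))).

Lemma G_H q x : x \in H q -> lspan (G q) x.
Proof. by move=> xH; apply: lspan_in; rewrite /mem_of mem_cat xH. Qed.
Lemma G_E q x : x \in E q -> lspan (G q) x.
Proof. by move=> xE; apply: lspan_in; rewrite /mem_of !mem_cat xE orbT. Qed.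
Lemma G_bdE q x : x \in E q.+1 -> lspan (G q) (bd x).
Proof. by move=> xE; apply: lspan_in; rewrite /mem_of !mem_cat (map_f bd xE) !orbT. Qed.

Lemma G_W' q x : W A' q x -> lspan (G q) x.
Proof.
have [_ _ sp _ _] := split'.
move=> /sp Wx; apply: lspan_trans Wx _ => y; rewrite /mem_of !mem_cat => /or3P [].
- by move/in_H_sub; apply: G_H.
- by move/in_E_sub; apply: G_E.
- by case/mapP=> z /in_E_sub zE ->; apply: G_bdE.
Qed.

Lemma G_sh q x : W A' q x -> lspan (G q.+1) (sh x).
Proof.
have [_ _ sp _ _] := split'.
move=> /sp Wx; apply: lspan_lin Wx _ => y; rewrite /mem_of !mem_cat => /or3P [].
- by move/in_H_sh; apply: G_H.
- by move/in_E_sh; apply: G_E.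
- case/mapP=> z /in_E_sh zE ->; rewrite -[X in lspan _ X]opprK -bd_sh.
  by apply/lspanN/G_bdE.
Qed.

Lemma lspan_mulr (S S' : F -> Prop) x y : lspan S y ->
  (forall t, S t -> lspan S' (x * t)) -> lspan S' (x * y).
Proof.
move=> Sy Sx; apply: (lspan_mul (S := eq x)) Sy _; first exact: lspan_in.
by move=> _ t <-; apply: Sx.
Qed.

Lemma lspan_mull (S S' : F -> Prop) x y : lspan S x ->
  (forall t, S t -> lspan S' (t * y)) -> lspan S' (x * y).
Proof.
move=> Sx Sy; apply: (lspan_mul (S' := eq y)) Sx _ _; first exact: lspan_in.
by move=> t _ + <-; apply: Sy.
Qed.

(** Split x along [H'], [E'] and the boundaries of [E']; after an element of [H'], split the tail as
    well. Wherever a boundary occurs, [bd_mul_socle] shows the product to be a boundary up to sign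
    and up to a term that vanishes (first factor a cycle) or is spanned by [E] (first factor from
    [E']). *)
Lemma G_sprod i j s x y : (forall z, W A j z -> lspan (G j) z) -> s \in Sc ->
  W A' i x -> W A j y -> lspan (G (i + j).+2) (sh x * (ltr s * y)).
Proof.
have [sH' sE' sp _ _] := split'; move=> IH sS /sp Wx Wy.
have Wsh k z : lspan (W A' k) z -> lspan (W A k.+1) (sh z).
  by move=> Wz; apply: sh_W => //; apply: lspanW_sub Wz.
have {}Wx : lspan (fun u => exists2 z, mem_of (H' i ++ E' i ++ map bd (E' i.+1)) z
    & u = sh z) (sh x).
  by apply: lspan_lin Wx _ => z zG; apply: lspan_in; exists z.
apply: lspan_mull Wx _ => _ [z + ->]; rewrite /mem_of !mem_cat => /or3P [].
- move=> zH; have [Wz dz] := sH' _ _ zH; rewrite mulrA.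
  apply: lspan_mulr (IH _ Wy) _ => t; rewrite /mem_of !mem_cat -mulrA => /or3P [].
  + by move=> tH; apply/G_H/in_H_sprod.
  + by move=> tE; apply/G_E/in_E_sprod.
  + case/mapP => e eE ->.
    have := bd_mul_socle (fun a => socle sS) (Wsh _ _ Wz) (E_words eE).
    rewrite bd_sh dz linear0 oppr0 mul0r sub0r => Ed.
    have -> : sh z * (ltr s * bd e) = - (-1) ^+ i.+1 *: bd (sh z * (ltr s * e)).
      by rewrite Ed scaleNr scalerN opprK scalerA -exprMn mulrNN mulr1 expr1n scale1r.
    by apply/lspanZ/G_bdE; rewrite -addnS; apply: in_E_sprod.
- by case: Wy => w wA -> zE; apply/G_E/in_E_sprod_word.
- case/mapP => e eE ->.
  have := bd_mul_socle (fun a => socle sS) (Wsh _ _ (sE' _ _ eE)) (lspan_in Wy).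
  rewrite bd_sh mulNr; move/(congr1 (fun u => - u)); rewrite opprD !opprK => /eqP.
  rewrite -subr_eq => /eqP <-; apply: lspanB.
    apply/lspanN/G_bdE; case: Wy => w wA ->; rewrite -addSn.
    exact: in_E_sprod_word.
  apply: lspanZ; rewrite mulrA; case: j IH Wy => [|j] IH Wy.
    by rewrite (bd_W0 (lspan_in Wy)) mulr0; apply: lspan0.
  apply: lspan_mulr (bd_W clA (lspan_in Wy)) _ => t [w wA ->].
  rewrite -mulrA; apply: G_E; rewrite addnS -addSn.
  exact: in_E_sprod_word.
Qed.

(** The first letter outside [A'] is p here and some p c in [u_type]. There the bound [k] on its
    position is the quantity that the later induction decreases. *)
Definition p_type q (x : F) := exists i j b r,
  [/\ (i + j).+1 = q, b \in words A' i, r \in words A j & x = wd (b ++ p :: r)].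

Definition u_type k q (x : F) := exists i j b c r,
  [/\ (i < k)%N, (i + j).+1 = q, b \in words A' i, c \in Cc /\ r \in words A j
    & x = wd (b ++ (p * c)%N :: r)].

Lemma sh_wd b i : size b = i ->
  sh (wd b) = (-1) ^+ i *: wd (b ++ [:: p])
    + \sum_(t < i) (-1) ^+ t *: wd (take t b ++ p :: drop t b).
Proof.
by move=> <-; rewrite falg_lextE /sh_word big_ord_recr /= take_size drop_size addrC.
Qed.

(** Induction on the position of p. Up to sign b | p is the last term of sh(b), and the other terms
    have p further left. This leaves sh(b) | r, where r is empty or starts with a socle letter; if r
    starts with a letter of [Cc], the given word already belongs to [E]. *)
Lemma G_p_type q x : (forall m z, (m < q)%N -> W A m z -> lspan (G m) z) ->
  p_type q x -> lspan (G q) x.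
Proof.
move=> IH [i]; elim/ltn_ind: i x => i IHi x [j [b [r [Eq bA rA ->]]]].
have [sb Ab] : size b = i /\ all (mem A') b.
  by move: bA; rewrite mem_words => /andP [/eqP].
have [sr Ar] : size r = j /\ all (mem A) r.
  by move: rA; rewrite mem_words => /andP [/eqP].
suff Gb : (exists c r', [/\ c \in Cc, r = c :: r' & j = (size r').+1])
    \/ lspan (G q) (sh (wd b) * wd r).
  case: Gb => [[c [r' [cC Er Ej]]]|Gb].
    rewrite Er -Eq Ej addnS; apply/G_E/in_E_D => //.
    by rewrite mem_words eqxx; move: Ar; rewrite Er => /andP [].
  have -> : wd (b ++ p :: r) = (-1) ^+ i *: (sh (wd b) * wd r
      - \sum_(t < i) (-1) ^+ t *: wd (take t b ++ p :: (drop t b ++ r))).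
    rewrite (sh_wd sb) mulrDl -scalerAl -falg_wd_cat -catA cat1s.
    rewrite mulr_suml.
    rewrite (eq_bigr (fun t : 'I_i => (-1) ^+ t *: wd (take t b ++ p :: (drop t b ++ r)))).
      by rewrite addrK scalerA -exprMn mulrNN mulr1 expr1n scale1r.
    by move=> t _; rewrite -scalerAl -falg_wd_cat -catA cat_cons.
  apply/lspanZ/lspanB => //; apply: lspan_sum => t _; apply: lspanZ.
  move: (Ab); rewrite -{1}(cat_take_drop t b) all_cat => /andP [At Ad].
  apply: (IHi t) => //; exists (i - t + j)%N, (take t b), (drop t b ++ r); split=> //.
  - by rewrite addnA subnKC // ltnW.
  - by rewrite mem_words size_takel ?sb ?(ltnW (ltn_ord t)) // eqxx.
  - rewrite mem_words size_cat size_drop sb sr eqxx all_cat Ar andbT.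
    by apply: (sub_all sA').
case: r rA sr Ar => [|a r] rA /= sr Ar.
  right; rewrite (falg_wd_nil F) mulr1 -Eq -sr addn0; apply: G_sh.
  by exists b.
case/andP: Ar => Aa Ar; move: (Aa); rewrite /= (perm_mem A_split) mem_cat => /orP [aS|aC].
  right; rewrite wd_cons -Eq -sr addnS; apply: G_sprod => //.
  - by move=> z; apply: IH; rewrite -Eq -sr addnS ltnS leqW ?leq_addl.
  - by exists b.
  - by exists r => //; rewrite mem_words eqxx.
by left; exists a, r.
Qed.

(** Merging p with c gives the leading term. Every other merge leaves p as the first letter outside
    [A'], except the merge of p with the letter a before it: this puts a p one place further left,
    and a lies in [Cc] because a p is at most n. *)
Lemma bd_D i j b c r : b \in words A' i -> c \in Cc -> r \in words A j ->
  lspan (fun x => p_type (i + j).+1 x \/ u_type i (i + j).+1 x)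
    (bd (wd (b ++ p :: c :: r)) - (-1) ^+ i *: wd (b ++ (p * c)%N :: r)).
Proof.
move=> + cC rA; elim: i b => [|i IH] b.
  rewrite inE => /eqP -> /=; rewrite (wd_cons p) bd_cons (wd_cons c r) mu_cons Cc_le //.
  rewrite (wd_cons (p * c)%N r) expr0 scale1r addrAC subrr sub0r; apply: lspanN.
  have Wcr : W A j.+1 (ltr c * wd r).
    by rewrite -add1n; apply: W_mul; [apply/W_ltr/sCc | exists r].
  apply: lspan_mulr (bd_W clA (lspan_in Wcr)) _ => _ [w wA ->]; rewrite -wd_cons.
  by apply: lspan_in; left; exists 0%N, j, [::], w.
rewrite mem_words; case: b => [//|a b] /= /andP [sb /andP [A'a A'b]].
have bA : b \in words A' i by rewrite mem_words A'b -eqSS sb.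
have Aa := sA' A'a.
rewrite wd_cons bd_cons (wd_cons a (b ++ _ :: r)) exprS mulN1r scaleNr opprK.
rewrite -addrA -falg_mulrZ [- _ + _]addrC -mulrBr -opprB mulrN.
apply: lspanB; last first.
  apply: lspan_mulr (IH _ bA) _ => t [[i' [j' [b' [r' [Eq bA' rA' ->]]]]]|].
    apply: lspan_in; left; exists i'.+1, j', (a :: b'), r'; split=> //.
    - by rewrite !addSn Eq.
    - by move: bA'; rewrite !mem_words /= eqSS A'a.
    - by rewrite -wd_cons.
  move=> [i' [j' [b' [c' [r' [ii Eq bA' cr ->]]]]]].
  apply: lspan_in; right; exists i'.+1, j', (a :: b'), c', r'; split=> //.
  - by rewrite !addSn Eq.
  - by move: bA'; rewrite !mem_words /= eqSS A'a.
  - by rewrite -wd_cons.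
case: b A'b sb bA => [|d b] /= A'b sb bA.
  have i0 : i = 0%N by case: i sb {IH bA}.
  rewrite wd_cons mu_cons; case: ifP => [/andP [_ ap]|_]; last exact: lspan0.
  have aC : a \in Cc.
    move: (Aa); rewrite (perm_mem A_split) mem_cat => /orP [aS|//].
    by have := socle aS Ap; rewrite ltnNge mulnC ap.
  rewrite -wd_cons; apply: lspan_in; right; exists 0%N, j.+1, [::], a, (c :: r).
  rewrite i0 mulnC; split=> //; split=> //.
  by move: rA; rewrite !mem_words /= eqSS sCc.
rewrite wd_cons mu_cons; case: ifP => [/andP [_ ad]|_]; last exact: lspan0.
case/andP: A'b => A'd A'b; rewrite -wd_cons.
apply: lspan_in; left; exists i, j.+1, ((a * d)%N :: b), (c :: r); split=> //.
- by rewrite addnS.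
- by move: bA; rewrite !mem_words /= clA' //= => /and3P [-> _ ->].
- by move: rA; rewrite !mem_words /= eqSS sCc.
Qed.

(** Replacing b | p c | r by the boundary of b | p | c | r costs only words of p type and words of u
    type whose p c' stands strictly further left. *)
Lemma G_u_type k q x : (forall m z, (m < q)%N -> W A m z -> lspan (G m) z) ->
  u_type k q x -> lspan (G q) x.
Proof.
move=> IH; elim: k x => [x [i [j [b [c [r []]]]]] //|k IHk x].
move=> [i [j [b [c [r [ik Eq bA [cC rA] ->]]]]]].
have Dx := bd_D bA cC rA.
(* Write x as (-1)^i ((-1)^i x), so that the inner multiple is the leading term in [bd_D]. *)
rewrite -[X in lspan _ X]scale1r -(expr1n _ i) -(mulr1 1) -mulrNN exprMn -scalerA.
set y := _ *: wd _; apply: lspanZ.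
rewrite -[y](subKr (bd (wd (b ++ p :: c :: r)))); apply: lspanB.
  by rewrite -Eq; apply/G_bdE/in_E_D.
apply: lspan_trans Dx _ => t; rewrite Eq => -[|[i' [j' [b' [c' [r' [ii Eq' bA' cr ->]]]]]]].
  exact: G_p_type.
by apply: IHk; exists i', j', b', c', r'; split=> //; apply: leq_trans ii _.
Qed.

Lemma word_cases q x : W A q x -> [\/ W A' q x, p_type q x | exists k, u_type k q x].
Proof.
elim: q x => [|q IH] x; first by move/W0P->; apply/Or31/W0.
case/WSP => a [y [Aa Wy ->]].
move: (Aa); rewrite (perm_mem A_split_p) mem_cat inE => /orP [A'a|/orP [/eqP ->|]].
- case: (IH _ Wy) => [W'y|[i [j [b [r [Eq bA rA ->]]]]]|[k [i [j [b [c [r [ik Eq bA cr ->]]]]]]]].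
  + by apply: Or31; rewrite -add1n; apply: W_mul => //; apply: W_ltr.
  + apply: Or32; exists i.+1, j, (a :: b), r; rewrite -wd_cons addSn Eq; split=> //.
    by move: bA; rewrite !mem_words /= eqSS A'a.
  + apply: Or33; exists k.+1, i.+1, j, (a :: b), c, r; rewrite -wd_cons addSn Eq; split=> //.
    by move: bA; rewrite !mem_words /= eqSS A'a.
- case: Wy => r rA ->; apply: Or32; exists 0%N, q, [::], r.
  by split=> //; rewrite -wd_cons.
- case/mapP=> c cC ->; case: Wy => r rA ->; apply: Or33; exists 1%N, 0%N, q, [::], c, r.
  by split=> //; rewrite -wd_cons.
Qed.

Lemma G_words q x : W A q x -> lspan (G q) x.
Proof.
elim/ltn_ind: q x => q IH x /word_cases [|Px|[k Ux]].
- exact: G_W'.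
- exact: (G_p_type (fun m z mq => IH m mq z) Px).
- exact: (G_u_type (fun m z mq => IH m mq z) Ux).
Qed.

Lemma size_sft f q : size (sft f q) = if q is q'.+1 then size (f q') else 0%N.
Proof. by case: q. Qed.

Lemma size_Hnext q : (size (H q) = size (H' q) + (if q is q'.+1 then size (H' q') else 0)
  + size Sc * cv (size \o H') (size \o H) q.-1)%N.
Proof.
rewrite H_eq !size_cat size_sft addnA; congr (_ + _)%N.
  by case: q => // q; rewrite size_map.
rewrite (@size_convl _ (fun i => size Sc * size (H' i))%N (size \o H)).
  by rewrite /cv big_distrr; apply: eq_bigr => i _; rewrite /= mulnA.
by move=> i j; rewrite size_sprod mulnA.
Qed.

Lemma size_Enext q : (size (E q) = size (E' q) + (if q is q'.+1 then size (E' q') else 0)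
  + size Cc * cv (expn (size A')) (expn (size A)) q.-1
  + size Sc * (cv (size \o E') (expn (size A)) q.-1 + cv (size \o H') (size \o E) q.-1))%N.
Proof.
rewrite E_eq !size_cat size_sft !addnA mulnDr addnA; congr (_ + _ + _ + _ + _)%N.
- by case: q => // q; rewrite size_map.
- rewrite (@size_convl _ (fun i => size Cc * size A' ^ i)%N (expn (size A))).
    by rewrite /cv big_distrr; apply: eq_bigr => i _; rewrite /= mulnA.
  by move=> i j; rewrite !size_allpairs !size_words [(size Cc * _)%N]mulnC.
- rewrite (@size_convl _ (fun i => size Sc * size (E' i))%N (expn (size A))).
    by rewrite /cv big_distrr; apply: eq_bigr => i _; rewrite /= mulnA.
  by move=> i j; rewrite size_sprod size_map size_words mulnA.
- rewrite (@size_convl _ (fun i => size Sc * size (H' i))%N (size \o E)).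
    by rewrite /cv big_distrr; apply: eq_bigr => i _; rewrite /= mulnA.
  by move=> i j; rewrite size_sprod mulnA.
Qed.

Lemma cv_shiftl (f g : nat -> nat) m : f 0%N = 0%N -> cv f g m.+1 = cv (f \o S) g m.
Proof.
move=> f0; rewrite /cv big_ord_recl f0 mul0n add0n; apply: eq_bigr => -[i im] _ /=.
by rewrite /bump /= add1n; case: m im => // m _; rewrite subSS.
Qed.

Lemma cv_shiftr (f g : nat -> nat) m : g 0%N = 0%N -> cv f g m.+1 = cv f (g \o S) m.
Proof.
move=> g0; rewrite /cv big_ord_recr /= subnn g0 muln0 addn0.
by apply: eq_bigr => -[i im] _ /=; case: m im => // m im; rewrite subSn.
Qed.

Lemma cv_expn a b m : (b * cv (expn a) (expn b) m + a ^ m = cv (expn a) (expn b) m.+1)%N.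
Proof.
rewrite /cv big_ord_recr /= subnn expn0 muln1 big_distrr; congr (_ + _)%N.
apply: eq_bigr => -[i im] _ /=; case: m im => // m im.
by rewrite subSn // expnS mulnCA.
Qed.

(** Classify the words over a + d letters by the position of the first of the d letters. *)
Lemma expn_cv a d m : ((a + d) ^ m = a ^ m + d * cv (expn a) (expn (a + d)) m)%N.
Proof.
elim: m => [|m IH]; first by rewrite /cv big_ord0 muln0.
rewrite -cv_expn expnS mulnDr IH; set c := cv _ _ _.
rewrite [(a ^ m.+1)%N]expnS; ring.
Qed.

Lemma step_sizes q : (size (H q) + size (E q) + size (E q.+1) = size A ^ q)%N.
Proof.
have [_ _ _ sz' E0'] := split'.
have e0 : (size \o E') 0%N = 0%N by rewrite /= E0'.
have e0' : (size \o E) 0%N = 0%N by rewrite /= E0.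
elim/ltn_ind: q => -[_|m IH].
  rewrite size_Hnext !size_Enext /= /cv !big_ord0 !muln0 !addn0.
  by have := sz' 0%N; rewrite E0' !expn0 !addn0.
have sA1 := perm_size A_split; have sA2 := perm_size A_split_p.
rewrite size_cat in sA1; rewrite size_cat /= size_map in sA2.
rewrite size_Hnext !size_Enext /= (cv_shiftl _ _ e0) (cv_shiftr _ _ e0').
(* For i + j = m - 1 the three terms containing [H'] add up to |H'_i| |A|^j by induction; with the
   other two they give (|H'_i| + |E'_i| + |E'_(i+1)|) |A|^j = |A'|^i |A|^j. *)
have key : (cv (size \o H') (size \o H) m + cv (size \o E') (expn (size A)) m
   + cv (size \o H') (size \o E) m + cv ((size \o E') \o S) (expn (size A)) m
   + cv (size \o H') ((size \o E) \o S) m = cv (expn (size A')) (expn (size A)) m)%N.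
  rewrite /cv -!big_split; apply: eq_bigr => -[i im] _ /=.
  rewrite -sz' -IH; first ring.
  by rewrite ltnS (leq_trans (leq_subr _ _)) ?leq_pred.
have hY := cv_expn (size A') (size A) m.
(* The |Cc| + 1 letters outside [A'] are p and the p c. *)
have hN := expn_cv (size A') (size Cc).+1 m.+1.
rewrite -[(size A' + _)%N]sA2 in hN; rewrite hN.
have {}key := congr1 (muln (size Sc)) key.
rewrite {1}sA1 !(mulnDl, mulnDr) in hY; rewrite !mulnDr in key *.
have h' := sz' m; have h'' := sz' m.+1.
rewrite mulSn; move: hY key h' h''.
move: (size A' ^ m.+1)%N (size A' ^ m)%N (cv _ _ m.+1) => a1 a0 Y.
do 6!move: (size Sc * _)%N => ?; do 2!move: (size Cc * _)%N => ?.
clear; lia.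
Qed.

Lemma step_splitting : bar_splitting A H E.
Proof.
by split; [exact: H_cycles | exact: E_words | exact: G_words | exact: step_sizes | exact: E0].
Qed.

End Step.

Lemma bar_splitting_nil :
  bar_splitting [::] (fun q => if q is 0%N then [:: 1] else [::]) (fun _ => [::]).
Proof.
split=> //.
- by case=> // x; rewrite inE => /eqP ->; split; [exact/lspan_in/W0 | exact: bd_nil].
- case=> [|q] x; last by case/WSP=> a [y []].
  by move/W0P->; apply: lspan_in; rewrite /mem_of inE.
- by case=> // q; rewrite exp0n.
Qed.

Lemma bar_splitting_extend p A A' Sc Cc H' E' :
  perm_eq A (Sc ++ Cc) -> perm_eq A (A' ++ p :: map (muln p) Cc) ->
  mul_closed A -> mul_closed A' ->
  (forall s a, s \in Sc -> a \in A -> (n < a * s)%N) ->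
  (forall c, c \in Cc -> (0 < p * c <= n)%N) ->
  bar_splitting A' H' E' ->
  exists H E, bar_splitting A H E /\ forall q,
    (size (H q) = size (H' q) + (if q is q'.+1 then size (H' q') else 0)
      + size Sc * cv (size \o H') (size \o H) q.-1)%N.
Proof.
move=> A1 A2 clA clA' soc Cle sp.
have [H HE] : exists H, forall q, H q = Hnext p Sc H' H q.
  apply: exists_fixpoint => f g q fg; congr (_ ++ (_ ++ _)).
  by apply: convl_ext => i j jq; rewrite fg.
have [E EE] : exists E, forall q, E q = Enext p A A' Sc Cc H' E' E q.
  apply: exists_fixpoint => f g q fg; congr (_ ++ (_ ++ (_ ++ (_ ++ _)))).
  by apply: convl_ext => i j jq; rewrite fg.
exists H, E; split; first exact: (step_splitting A1 A2 clA clA' soc Cle sp HE EE).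
exact: size_Hnext HE.
Qed.

(** The closed form can be compared entry by entry with [dbar], whose signs are opposite. *)
Lemma bd_wordE w : bd (wd w) = \sum_(l < (size w).-1) (-1) ^+ l *:
  (if (0 < nth 0 w l * nth 0 w l.+1 <= n)%N then
     wd (take l w ++ (nth 0 w l * nth 0 w l.+1)%N :: drop l.+2 w) else 0).
Proof.
elim: w => [|a w IH]; first by rewrite (falg_wd_nil F) bd_nil big_ord0.
rewrite wd_cons bd_cons IH.
case: w {IH} => [|b w]; first by rewrite !big_ord0 (falg_wd_nil F) mu_nil mulr0 subr0.
rewrite [in RHS]big_ord_recl wd_cons mu_cons -wd_cons /= expr0 scale1r drop0.
congr (_ + _); rewrite mulr_sumr -sumrN; apply: eq_bigr => i _.
rewrite falg_mulrZ exprS mulN1r scaleNr; congr (- (_ *: _)).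
by case: ifP => _; rewrite ?mulr0 // -wd_cons.
Qed.
End Bar.

(** * Ranks of the bar differential *)

Section BarRank.
Variables (K : fieldType) (F : free_algebra K) (n : nat).
Local Notation wd := (@falg_wd K F).
Local Notation N := n.-1.
Local Notation letters := (iota 2 n.-1).
Local Notation bd := (bd F n).
Local Notation dbar := (dbar (@cGam n K)).

Definition bar_word q (s : barIdx N q) : seq nat := [seq (s i : nat).+2 | i <- enum 'I_q].

Lemma size_bar_word q (s : barIdx N q) : size (bar_word s) = q.
Proof. by rewrite size_map size_enum_ord. Qed.

Lemma nth_bar_word q (s : barIdx N q) (i : 'I_q) : nth 0%N (bar_word s) i = (s i).+2.
Proof. by rewrite (nth_map i) ?size_enum_ord // nth_ord_enum. Qed.

Lemma bar_word_inj q : injective (@bar_word q).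
Proof.
move=> s t st; apply/ffunP => i; apply/val_inj.
by have := nth_bar_word s i; rewrite st nth_bar_word => -[].
Qed.

Lemma bar_word_words q (s : barIdx N q) : bar_word s \in words letters q.
Proof.
rewrite mem_words size_bar_word eqxx; apply/allP => a /mapP [i _ ->].
by rewrite /= mem_iota /= add2n !ltnS ltn_ord.
Qed.

Definition bar_vec q : {linear F -> 'rV[K]_#|barIdx N q|} :=
  falg_lext (fun w => \row_j ((w == bar_word (enum_val j))%:R : K)).

Lemma bar_vecE q (s : barIdx N q) :
  bar_vec q (wd (bar_word s)) = delta_mx 0 (enum_rank s).
Proof.
rewrite falg_lextE; apply/rowP => j; rewrite !mxE (inj_eq (@bar_word_inj q)) eqxx /=.
by rewrite -(inj_eq enum_val_inj) enum_rankK eq_sym.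
Qed.

Lemma cGamE (a b k : 'I_N) :
  @cGam n K a b k = ((a.+2 * b.+2 == k.+2)%N)%:R :> K.
Proof.
have kn : (k.+1 < n)%N by have := ltn_ord k; lia.
rewrite /cGam (big_pred1 (Ordinal kn)); last first.
  by move=> m; apply/eqP/eqP => [mk|->] //; apply/val_inj.
have an : (a.+1 < n)%N by have := ltn_ord a; lia.
have bn : (b.+1 < n)%N by have := ltn_ord b; lia.
rewrite ffunE (bigD1 (Ordinal an)) //= [X in _ + X]big1 ?addr0; last first.
  move=> i ia; apply: big1 => j _; rewrite ffunE (_ : (_ == a.+1) = false) ?mul0r //.
  by apply/negbTE; apply: contraNneq ia => ia; apply/eqP/val_inj.
case: (boolP (a.+2 * b.+2 == k.+2)%N) => abk.
  rewrite (bigD1 (Ordinal bn)) //= big1 ?addr0; first by rewrite !ffunE !eqxx mulr1.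
  move=> j /andP [_ jb]; rewrite [X in _ * X]ffunE (_ : (_ == b.+1) = false) ?mulr0 //.
  by apply/negbTE; apply: contraNneq jb => jb; apply/eqP/val_inj.
apply: big1 => j jab; rewrite [X in _ * X]ffunE (_ : (_ == b.+1) = false) ?mulr0 //.
by apply/negbTE; apply: contraNneq abk => jb; rewrite jb in jab.
Qed.

Lemma merge_eq q (s : barIdx N q.+1) (t : barIdx N q) (l : 'I_q) :
  (take l (bar_word s) ++ (nth 0 (bar_word s) l * nth 0 (bar_word s) l.+1)%N
     :: drop l.+2 (bar_word s) == bar_word t)
  = [&& [forall k : 'I_q, (k < l)%N ==> (t k == s (inord k))],
        [forall k : 'I_q, (l < k)%N ==> (t k == s (inord k.+1))] &
        (((s (inord l)).+2 * (s (inord l.+1)).+2)%N == (t l).+2)].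
Proof.
have ws k : (k < q.+1)%N -> nth 0%N (bar_word s) k = (s (inord k)).+2.
  by move=> kq; rewrite -[k in LHS](inordK kq) nth_bar_word.
have lq := ltn_ord l; rewrite !ws // ?(ltn_trans lq) //.
set u := _ ++ _.
have su : size u = q.
  rewrite size_cat /= size_drop size_takel size_bar_word; lia.
have nu k : (k < q)%N -> nth 0%N u k = if (k < l)%N then (s (inord k)).+2 else
    if k == l :> nat then ((s (inord l)).+2 * (s (inord l.+1)).+2)%N
    else (s (inord k.+1)).+2.
  move=> kq; rewrite nth_cat size_takel ?size_bar_word; last by lia.
  case: ltnP => kl; first by rewrite nth_take // ws //; lia.
  case: eqP => [->|kl']; first by rewrite subnn.
  have -> : (k - l = (k - l.+1).+1)%N by lia.
  rewrite /= nth_drop (_ : (l.+2 + (k - l.+1) = k.+1)%N); last by lia.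
  by rewrite ws.
apply/eqP/and3P => [ut|[/forallP h1 /forallP h2 /eqP h3]].
  have tk (k : 'I_q) : (t k).+2 = nth 0%N u k by rewrite ut nth_bar_word.
  split.
  - apply/forallP => k; apply/implyP => kl; rewrite -val_eqE /=.
    by have := tk k; rewrite nu // kl => -[->].
  - apply/forallP => k; apply/implyP => kl; rewrite -val_eqE /=.
    by have := tk k; rewrite nu // ltnNge (ltnW kl) /= gtn_eqF // => -[->].
  - by apply/eqP; rewrite tk nu // ltnn eqxx.
apply: (@eq_from_nth _ 0%N); rewrite ?su ?size_bar_word // => k kq.
rewrite nu //; have := nth_bar_word t (Ordinal kq) => /= ->.
case: (ltngtP k l) => kl.
- by have /implyP/(_ kl)/eqP -> := h1 (Ordinal kq).
- by have /implyP/(_ kl)/eqP -> := h2 (Ordinal kq).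
- by rewrite h3; congr (_.+2); congr (val (t _)); apply/val_inj.
Qed.

Lemma bar_vec_bd_word q (s : barIdx N q.+1) :
  bar_vec q (bd (wd (bar_word s))) = - (bar_vec q.+1 (wd (bar_word s)) *m dbar q).
Proof.
rewrite bar_vecE -rowE; apply/rowP => j; rewrite !mxE enum_rankK.
rewrite bd_wordE size_bar_word /= linear_sum summxE -sumrN.
apply: eq_bigr => l _; rewrite linearZ mxE exprS mulN1r mulNr opprK; congr (_ * _).
have lq := ltn_ord l.
set t := enum_val j; have := merge_eq s t l; set u := _ ++ _ => Hu.
rewrite cGamE -natrM mulnb -andbA -Hu.
have nn : nth 0%N (bar_word s) l = (s (inord l)).+2.
  have lq1 : (l < q.+1)%N by lia.
  by rewrite -{1}(inordK lq1) nth_bar_word.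
have nn' : nth 0%N (bar_word s) l.+1 = (s (inord l.+1)).+2.
  have lq1 : (l.+1 < q.+1)%N by lia.
  by rewrite -{1}(inordK lq1) nth_bar_word.
(* A product exceeding n gives 0 on the left, and no basis word matches it on the right, since all
   its letters are at most n. *)
case: ifP => [_|bad]; first by rewrite falg_lextE mxE.
rewrite linear0 mxE (_ : (_ == _) = false) //; apply/negbTE.
rewrite Hu; apply: contraFN bad => /and3P [_ _ /eqP].
by rewrite nn nn' => ->; have := ltn_ord (t l); rewrite ltn_predRL.
Qed.

Lemma bar_vec_bd q x : lspan (W letters q.+1) x ->
  bar_vec q (bd x) = - (bar_vec q.+1 x *m dbar q).
Proof.
elim=> [|c _ {}x [w wA ->] _ IH]; first by rewrite !linear0 mul0mx oppr0.
rewrite !linearP IH mulmxDl -scalemxAl opprD -scalerN; congr (_ *: _ + _).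
have [s ->] : exists s : barIdx N q.+1, w = bar_word s.
  move: wA; rewrite mem_words => /andP [/eqP sw Aw].
  have wl (i : 'I_q.+1) : (nth 0%N w i - 2 < N)%N.
    have : nth 0%N w i \in letters by apply: (allP Aw); rewrite mem_nth ?sw.
    by rewrite mem_iota; lia.
  exists [ffun i => Ordinal (wl i)].
  apply: (@eq_from_nth _ 0%N); rewrite ?size_bar_word // => i; rewrite sw => iq.
  rewrite (nth_bar_word _ (Ordinal iq)) ffunE /=.
  have : nth 0%N w i \in letters by apply: (allP Aw); rewrite mem_nth ?sw.
  by rewrite mem_iota; lia.
exact: bar_vec_bd_word.
Qed.

Definition rows_of q (L : seq F) : 'M[K]_(size L, _) := \matrix_i bar_vec q L`_i.

Lemma rows_of_sub q L x : lspan (mem_of L) x -> (bar_vec q x <= rows_of q L)%MS.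
Proof.
elim=> [|c y {}x yL _ IH]; first by rewrite linear0 sub0mx.
rewrite linearP addmx_sub // scalemx_sub //.
have iL : (index y L < size L)%N by rewrite index_mem.
have -> : bar_vec q y = row (Ordinal iL) (rows_of q L) by rewrite rowK /= nth_index.
exact: row_sub.
Qed.

Variables (H E : nat -> seq F).
Hypothesis splitHE : bar_splitting n letters H E.

Lemma card_barIdx q : #|{: barIdx N q}| = (N ^ q)%N.
Proof. by rewrite card_ffun !card_ord. Qed.

(** At most: the differential kills [H q.+1] and the boundaries, so only the images of [E q.+1]
    remain. At least: [H q], [E q] and the image of [dbar q] span degree q, of dimension |H q| + |E
    q| + |E q.+1|. *)
Lemma rank_dbar q : \rank (dbar q) = size (E q.+1).
Proof.
have [sH sE sp sz _] := splitHE.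
have row1 m (j : 'I_#|barIdx N m|) :
    row j 1%:M = bar_vec m (wd (bar_word (enum_val j))).
  by rewrite bar_vecE row1 enum_valK.
have Wj m (j : 'I_#|barIdx N m|) : W letters m (wd (bar_word (enum_val j))).
  by exists (bar_word (enum_val j)); rewrite ?bar_word_words.
apply/eqP; rewrite eqn_leq; apply/andP; split.
  rewrite -(size_map bd); apply: leq_trans (rank_leq_row (rows_of q _)).
  apply: mxrankS; apply/row_subP => i.
  rewrite rowE.
  have -> : delta_mx 0 i *m dbar q = - bar_vec q (bd (wd (bar_word (enum_val i)))).
    by rewrite bar_vec_bd_word opprK bar_vecE enum_valK.
  rewrite -scaleN1r; apply/scalemx_sub/rows_of_sub.
  apply: lspan_lin (sp _ _ (Wj _ i)) _ => x; rewrite /mem_of !mem_cat => /or3P [xH|xE|].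
  - by rewrite (sH _ _ xH).2; apply: lspan0.
  - by apply: lspan_in; apply: map_f.
  - by case/mapP=> y _ ->; rewrite bd_bd; apply: lspan0.
have le1 : (N ^ q <= size (H q) + size (E q) + \rank (dbar q))%N.
  rewrite -card_barIdx -[X in (X <= _)%N](mxrank1 K).
  have : (1%:M <= rows_of q (H q) + rows_of q (E q) + dbar q)%MS.
    apply/row_subP => j; rewrite row1.
    elim: (sp _ _ (Wj _ j)) => [|c y x yG _ IH]; first by rewrite linear0 sub0mx.
    rewrite linearP addmx_sub // scalemx_sub //.
    move: yG; rewrite /mem_of !mem_cat => /or3P [yH|yE|/mapP [z zE ->]].
    - apply: submx_trans (addsmxSl _ _); apply: submx_trans (addsmxSl _ _).
      exact/rows_of_sub/lspan_in.
    - apply: submx_trans (addsmxSl _ _); apply: submx_trans (addsmxSr _ _).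
      exact/rows_of_sub/lspan_in.
    - apply: submx_trans (addsmxSr _ _).
      by rewrite (bar_vec_bd (sE _ _ zE)) -mulNmx submxMl.
  move/mxrankS/leq_trans; apply; apply: leq_trans (mxrank_adds_leqif _ _) _.
  rewrite leq_add2r; apply: leq_trans (mxrank_adds_leqif _ _) _.
  by apply: leq_add; apply: rank_leq_row.
by move: le1; rewrite -{1}(size_iota 2 N) -sz leq_add2l.
Qed.

Lemma TorGam_splitting q : TorGam n K q = size (H q).
Proof.
have [_ _ _ sz E0] := splitHE.
have := sz q; rewrite size_iota /TorGam /dimTor rank_dbar card_barIdx => <-.
(* In degree 0 [dimTor] subtracts only one rank, which agrees with [E 0] being empty. *)
case: q => [|q]; first by rewrite E0 /= subn0 addn0 addnK.
by rewrite rank_dbar; lia.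
Qed.
End BarRank.

(** * The Poincaré series *)

Section PowerSeries.

(** Power series are replaced by truncations: agreement up to degree q becomes a polynomial identity
    with an explicit remainder, which [ring] can handle. *)
Lemma eq_modX (f g : {poly int}) q : (forall i, (i <= q)%N -> f`_i = g`_i) ->
  exists R, f = g + R * 'X ^+ q.+1.
Proof.
move=> fg; exists (drop_poly q.+1 (f - g)).
apply/eqP; rewrite addrC -subr_eq; apply/eqP.
rewrite -[LHS](poly_take_drop q.+1) (_ : take_poly _ _ = 0) ?add0r //.
apply/polyP => i; rewrite coef_take_poly coef0 ltnS coefB; case: ifP => // iq.
by rewrite fg ?subrr.
Qed.

Lemma coef_binX m q : ((1 + 'X : {poly int}) ^+ m)`_q = ('C(m, q))%:R.
Proof.
rewrite exprDn coef_sum.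
rewrite (eq_bigr (fun i : 'I_m.+1 => ('C(m, i))%:R * (q == i)%:R)); last first.
  by move=> i _; rewrite expr1n mul1r coefMn coefXn mulr_natr -!mulrnA mulnC.
case: (leqP q m) => qm.
  rewrite (bigD1 (Ordinal (qm : (q < m.+1)%N))) //= eqxx mulr1 big1 ?addr0 // => i iq.
  rewrite (_ : (q == i) = false) ?mulr0 //; apply/negbTE; apply: contraNneq iq => iq.
  exact/eqP/val_inj.
rewrite bin_small // big1 // => i _; rewrite (_ : (q == i) = false) ?mulr0 //.
by apply/negbTE; have := ltn_ord i; rewrite neq_ltn; lia.
Qed.

(* With [P], [P'] the generating series of [h], [h'], the second hypothesis says
   P = P' (1 + t + c t^2 P), hence P (D' - c t^2 (1+t)^m) = (1 + t) P' D'. *)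
Lemma series_step (h h' : nat -> nat) (c m : nat) (D' : {poly int}) :
  (forall q, \sum_(k < q.+1) (h' k)%:R * D'`_(q - k) = ('C(m, q))%:R) ->
  (forall q, (h q = h' q + (if q is q'.+1 then h' q' else 0) + c * cv h' h q.-1)%N) ->
  forall q, \sum_(k < q.+1) (h k)%:R * (D' - 'X ^+ 2 * ((1 + 'X) ^+ m * (c%:R)%:P))`_(q - k)
    = ('C(m.+1, q))%:R :> int.
Proof.
move=> Hh' Hh q.
pose P := \poly_(k < q.+1) ((h k)%:R : int).
pose P' := \poly_(k < q.+1) ((h' k)%:R : int).
have cP i : (i <= q)%N -> P`_i = (h i)%:R by move=> iq; rewrite coef_poly ltnS iq.
have cP' i : (i <= q)%N -> P'`_i = (h' i)%:R by move=> iq; rewrite coef_poly ltnS iq.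
have [R1 E1] : exists R, P' * D' = (1 + 'X) ^+ m + R * 'X ^+ q.+1.
  apply: eq_modX => i iq; rewrite coef_binX coefM -Hh'; apply: eq_bigr => k _.
  by rewrite cP' //; have := ltn_ord k; lia.
have [R2 E2] : exists R, P = (P' + P' * 'X + (P' * P * (c%:R)%:P) * 'X ^+ 2) + R * 'X ^+ q.+1.
  apply: eq_modX => i iq; rewrite cP // !coefD coefMX coefMXn coefMC Hh !natrD cP' //.
  congr (_ + _ + _).
    by case: i iq => //= i iq; rewrite cP' // ltnW.
  case: i iq => [|[|i]] iq; rewrite /= ?/cv ?big_ord0 ?muln0 //.
  rewrite subn2 /= coefM natrM mulrC natr_sum; congr (_ * _); apply: eq_bigr => k _.
  have := ltn_ord k => ki; rewrite natrM cP' ?cP //; lia.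
set D := D' - _.
have [R3 E3] : exists R, P * D = (1 + 'X) ^+ m.+1 + R * 'X ^+ q.+1.
  (* The remainders left when [E2] is multiplied by [D'] and then [P' * D'] is replaced by means of
     [E1]. *)
  exists (R2 * D' + (1 + 'X) * R1 + 'X ^+ 2 * (c%:R)%:P * P * R1).
  rewrite exprS /D mulrBr {1}E2.
  have E1' : P' * D' - R1 * 'X ^+ q.+1 = (1 + 'X) ^+ m by rewrite E1 addrK.
  rewrite -E1'; ring.
transitivity ((P * D)`_q).
  by rewrite coefM; apply: eq_bigr => k _; rewrite cP // -ltnS.
by rewrite E3 coefD coef_binX coefMXn ltnSn addr0.
Qed.
End PowerSeries.

(** * The primes up to n and the alphabets of the subalgebras *)

Section Primes.
Variable n : nat.
Local Notation r := (rr n).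
Local Notation pr := (pr n).

Lemma mem_primes_upto q : (q \in primes_upto n) = prime q && (q <= n)%N.
Proof.
rewrite mem_filter mem_iota; case: (boolP (prime q)) => //= pq.
by have := prime_gt1 pq; lia.
Qed.

Lemma pr_mem j : (j < r)%N -> pr j \in primes_upto n.
Proof. exact: mem_nth. Qed.

Lemma pr_prime j : (j < r)%N -> prime (pr j).
Proof. by move/pr_mem; rewrite mem_primes_upto => /andP []. Qed.

Lemma pr_le j : (j < r)%N -> (pr j <= n)%N.
Proof. by move/pr_mem; rewrite mem_primes_upto => /andP []. Qed.

Lemma uniq_primes_upto : uniq (primes_upto n).
Proof. by rewrite filter_uniq // iota_uniq. Qed.

Lemma sorted_primes_upto : sorted ltn (primes_upto n).
Proof. by apply: sorted_filter; [exact: ltn_trans | exact: iota_ltn_sorted]. Qed.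

Lemma pr_ltn i j : (i < j)%N -> (j < r)%N -> (pr i < pr j)%N.
Proof.
move=> ij jr; apply: (sorted_ltn_nth ltn_trans 0%N sorted_primes_upto) => //.
by rewrite inE (ltn_trans ij).
Qed.

Lemma pr_leq i j : (i <= j)%N -> (j < r)%N -> (pr i <= pr j)%N.
Proof. by rewrite leq_eqVlt => /orP [/eqP -> //|ij] jr; apply/ltnW/pr_ltn. Qed.

Lemma pr_inj i j : (i < r)%N -> (j < r)%N -> pr i = pr j -> i = j.
Proof. by move=> ir jr /eqP; rewrite nth_uniq ?uniq_primes_upto // => /eqP. Qed.

Lemma prP q : prime q -> (q <= n)%N -> exists2 j, (j < r)%N & pr j = q.
Proof.
move=> pq qn; have qm : q \in primes_upto n by rewrite mem_primes_upto pq.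
by exists (index q (primes_upto n)); rewrite ?index_mem // /Defs.pr nth_index.
Qed.

(** Primes are indexed from 0, so these are the integers in 2..n all of whose prime factors are at
    least [pr v]: every letter for v = 0, none for v = r. *)
Definition letters_from v :=
  [seq a <- iota 2 n.-1 | all (fun j => ~~ (pr j %| a)%N) (iota 0 v)].

Lemma mem_letters v a : reflect [/\ (1 < a)%N, (a <= n)%N &
    forall j, (j < v)%N -> ~~ (pr j %| a)%N] (a \in letters_from v).
Proof.
rewrite mem_filter mem_iota; apply: (iffP andP) => [[/allP h ha]|[a1 an h]].
  by split; [lia | lia |] => j jv; apply: h; rewrite mem_iota.
split; last by lia.
by apply/allP => j; rewrite mem_iota => /andP [_ jv]; apply: h.
Qed.

(** The least prime factor of a letter is some [pr j] with v <= j. Consequently a letter killed by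
    [pr v] is killed by every letter. *)
Lemma letters_min v a : (v < r)%N -> a \in letters_from v -> (pr v <= a)%N.
Proof.
move=> vr /mem_letters [a1 an ha].
have [j jr Ej] : exists2 j, (j < r)%N & pr j = pdiv a.
  by apply: prP; rewrite ?pdiv_prime // (leq_trans (pdiv_leq _)) // ltnW.
have vj : (v <= j)%N.
  by rewrite leqNgt; apply/negP => /ha; rewrite Ej pdiv_dvd.
by apply: leq_trans (pr_leq vj jr) _; rewrite Ej pdiv_leq // ltnW.
Qed.

Lemma letters_closed v : (v <= r)%N -> mul_closed n (letters_from v).
Proof.
move=> vr a b /mem_letters [a1 an ha] /mem_letters [b1 bn hb] ab.
apply/mem_letters; split=> // [|j jv]; first by rewrite (leq_trans a1) // leq_pmulr // ltnW.
by rewrite Euclid_dvdM ?pr_prime ?(leq_trans jv) // negb_or ha // hb.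
Qed.

Definition socle_letters v := [seq s <- letters_from v | (n < pr v * s)%N].
Definition cosocle_letters v := [seq s <- letters_from v | ~~ (n < pr v * s)%N].

Lemma letters_uniq v : uniq (letters_from v).
Proof. by rewrite filter_uniq // iota_uniq. Qed.

Lemma letters_split v :
  perm_eq (letters_from v) (socle_letters v ++ cosocle_letters v).
Proof. by rewrite perm_sym perm_filterC. Qed.

Lemma letters_split_p v : (v < r)%N -> perm_eq (letters_from v)
  (letters_from v.+1 ++ pr v :: map (muln (pr v)) (cosocle_letters v)).
Proof.
move=> vr; have pp := pr_prime vr; have p0 := prime_gt0 pp; have p1 := prime_gt1 pp.
have not_next x : (pr v %| x)%N -> x \notin letters_from v.+1.
  by move=> px; apply/negP => /mem_letters [_ _ /(_ v (ltnSn v))]; rewrite px.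
apply: uniq_perm; first exact: letters_uniq.
  rewrite cat_uniq letters_uniq /= negb_or not_next ?dvdnn //=; apply/and3P; split.
  - apply/hasPn => _ /mapP [c _ ->]; apply: not_next; exact: dvdn_mulr.
  - apply/negP => /mapP [c]; rewrite mem_filter => /andP [_ /mem_letters [c1 _ _]] /eqP.
    by rewrite -[X in X == _]muln1 eqn_pmul2l // => /eqP c1'; rewrite -c1' in c1.
  - rewrite map_inj_uniq; first by apply: filter_uniq; apply: letters_uniq.
    by move=> x y /eqP; rewrite eqn_pmul2l // => /eqP.
move=> a; rewrite mem_cat inE; apply/idP/or3P => [La|].
  case: (boolP (pr v %| a)%N) => [/dvdnP [c Ea]|pa]; last first.
    case/mem_letters: La => a1 an ha; apply: Or31; apply/mem_letters; split=> // j.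
    by rewrite ltnS leq_eqVlt => /orP [/eqP -> //|/ha].
  case/mem_letters: La => a1 an ha.
  case: (ltngtP c 1) => c1.
  - by move: a1; rewrite Ea; case: c c1 {Ea}.
  - apply: Or33; apply/mapP; exists c; last by rewrite mulnC.
    rewrite mem_filter -leqNgt mulnC -Ea an; apply/mem_letters; split=> //.
      by apply: leq_trans an; rewrite Ea leq_pmulr.
    by move=> j /ha; rewrite Ea; apply: contra; apply: dvdn_mulr.
  - by apply: Or32; rewrite Ea c1 mul1n.
case=> [|/eqP ->|/mapP [c]].
- case/mem_letters => a1 an ha; apply/mem_letters; split=> // j jv; apply: ha.
  exact: leq_trans jv _.
- apply/mem_letters; split=> //; first exact: pr_le.
  move=> j jv; have jr := ltn_trans jv vr; rewrite dvdn_prime2 ?pr_prime //.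
  by apply/eqP => /(pr_inj jr vr) jv'; rewrite jv' ltnn in jv.
- rewrite mem_filter -leqNgt => /andP [pc /mem_letters [c1 cn hc]] ->.
  apply/mem_letters; split=> //; first by rewrite (leq_trans p1) // leq_pmulr // ltnW.
  move=> j jv; have jr := ltn_trans jv vr.
  rewrite Euclid_dvdM ?pr_prime // negb_or hc // andbT dvdn_prime2 ?pr_prime //.
  by apply/eqP => /(pr_inj jr vr) jv'; rewrite jv' ltnn in jv.
Qed.

Lemma letters_from0 : letters_from 0 = iota 2 n.-1.
Proof. by rewrite /letters_from /= filter_predT. Qed.

Lemma letters_from_rr : letters_from r = [::].
Proof.
case E : (letters_from r) => [//|a s].
have /mem_letters [a1 an ha] : a \in letters_from r by rewrite E inE eqxx.
have [j jr Ej] : exists2 j, (j < r)%N & pr j = pdiv a.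
  by apply: prP; rewrite ?pdiv_prime // (leq_trans (pdiv_leq _)) // ltnW.
by have := ha j jr; rewrite Ej pdiv_dvd.
Qed.

(** [m] counts the primes adjoined so far, the largest first. The prime adjoined after k others
    contributes its socle with weight (1 + t)^k, which explains the order of the terms in the
    denominator. *)
Lemma letters_splitting (K : fieldType) (F : free_algebra K) m : (m <= r)%N ->
  exists H E : nat -> seq F, bar_splitting n (letters_from (r - m)) H E /\
  forall q, \sum_(k < q.+1) (size (H k))%:R *
    (1 - 'X ^+ 2 * \sum_(k < m) ((1 + 'X) ^+ k *
        ((size (socle_letters (r - k.+1)))%:R)%:P) : {poly int})`_(q - k)
    = ('C(m, q))%:R.
Proof.
elim: m => [_|m IH mr].
  rewrite subn0 letters_from_rr; eexists; eexists; split; first exact: bar_splitting_nil.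
  move=> q; rewrite big_ord_recl big_ord0 mulr0 subr0 subn0 coef1 mul1r big1 ?addr0.
    by case: q => [|q] //=; rewrite bin_small.
  by move=> i _; rewrite mul0r.
have [H' [E' [sp ser]]] := IH (ltnW mr).
set v := (r - m.+1)%N; have vS : v.+1 = (r - m)%N by rewrite /v subnSK.
have vr : (v < r)%N by rewrite vS leq_subr.
have [||s a|c||H [E [spHE sz]]] := @bar_splitting_extend K F n (pr v)
    (letters_from v) (letters_from v.+1)
    (socle_letters v) (cosocle_letters v) H' E'
    (letters_split v) (letters_split_p vr).
- by apply: letters_closed; apply: ltnW.
- exact: letters_closed.
- rewrite mem_filter => /andP [sn _] /(letters_min vr) pa.
  by apply: leq_trans sn _; rewrite leq_mul2r pa orbT.
- rewrite mem_filter -leqNgt => /andP [-> /mem_letters [c1 _ _]].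
  by rewrite muln_gt0 prime_gt0 ?pr_prime // ltnW.
- by rewrite vS.
exists H, E; split=> // q.
rewrite [\sum_(_ < m.+1) _]big_ord_recr /= mulrDr opprD addrA.
exact: (series_step ser sz).
Qed.
End Primes.

(** * Monomials and integers *)

Section Exponents.
Variable n : nat.
Local Notation r := (rr n).
Local Notation pr := (pr n).
Implicit Types (a b m : 'X_{1..r}).

Lemma pr_gt0 (j : 'I_r) : (0 < pr j)%N.
Proof. exact/prime_gt0/pr_prime. Qed.

Lemma mval_gt0 a : (0 < mval a)%N.
Proof. by apply: prodn_gt0 => j; rewrite expn_gt0 pr_gt0. Qed.

Lemma mvalD a b : mval (a + b)%MM = (mval a * mval b)%N.
Proof. by rewrite -big_split; apply: eq_bigr => j _; rewrite mnmDE expnD. Qed.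

Lemma mvalU (j : 'I_r) : mval U_(j)%MM = pr j.
Proof.
rewrite /mval (bigD1 j) //= mnm1E eqxx expn1 big1 ?muln1 // => i ij.
by rewrite mnm1E eq_sym (negbTE ij).
Qed.

Lemma mval0 : mval (0%MM : 'X_{1..r}) = 1%N.
Proof. by apply: big1 => j _; rewrite mnm0E. Qed.

Lemma mval_le a b : (forall i, a i <= b i)%N -> (mval a <= mval b)%N.
Proof. by move=> ab; apply: leq_prod => j _; rewrite leq_pexp2l // pr_gt0. Qed.

Lemma logn_mval q a : logn q (mval a) = (\sum_(j < r) a j * (q == pr j))%N.
Proof.
suff [] : (logn q (mval a) = \sum_(j < r) a j * (q == pr j))%N /\ (0 < mval a)%N by [].
rewrite /mval; elim/big_rec2: _ => [|j s m _ [<- m0]]; first by rewrite logn1.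
 have p0 : (0 < pr j ^ a j)%N by rewrite expn_gt0 pr_gt0.
by rewrite lognM // lognX logn_prime ?pr_prime // muln_gt0 p0 m0.
Qed.

Definition expv (w : nat) : 'X_{1..r} := [multinom logn (pr j) w | j < r].

Lemma mvalK : cancel (@mval n) expv.
Proof.
move=> a; apply/mnmP => i; rewrite mnmE logn_mval (bigD1 i) //= eqxx muln1 big1 ?addn0 //.
move=> j ji; case: eqP => [/(pr_inj (ltn_ord i) (ltn_ord j)) ij|]; last by rewrite muln0.
by case/eqP: ji; apply: val_inj.
Qed.

(** Every prime factor of w is at most n, so the exponents at the r available primes determine w. *)
Lemma expvK w : (0 < w <= n)%N -> mval (expv w) = w.
Proof.
case/andP=> w0 wn; apply: eqn_from_log => //; first exact: mval_gt0.
move=> q; rewrite logn_mval.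
case: (boolP (q \in primes_upto n)) => [qn|qn].
  have qr : (index q (primes_upto n) < r)%N by rewrite index_mem.
  rewrite (bigD1 (Ordinal qr)) //= big1 ?addn0.
    by rewrite mnmE /= /Defs.pr nth_index // eqxx muln1.
  move=> j ji; case: eqP => [Eq|]; last by rewrite muln0.
  case/eqP: ji; apply: val_inj => /=.
  by rewrite Eq /Defs.pr index_uniq ?uniq_primes_upto.
rewrite big1 => [|j _]; last first.
  by case: eqP => [Eq|]; [case/negP: qn; rewrite Eq pr_mem | rewrite muln0].
apply/esym/eqP; rewrite -leqn0 leqNgt logn_gt0 mem_primes w0 /=.
apply/negP => /andP [pq qw]; case/negP: qn; rewrite mem_primes_upto pq.
by apply: leq_trans (dvdn_leq w0 qw) wn.
Qed.

Lemma lambdaE w : (0 < w <= n)%N -> lambda w = mdeg (expv w).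
Proof.
case/andP=> w0 wn; rewrite mdegE /lambda.
under [RHS]eq_bigr do rewrite mnmE.
have -> : (\sum_(j < r) logn (pr j) w = \sum_(q <- primes_upto n) logn q w)%N.
  by rewrite (big_nth 0%N) big_mkord.
rewrite [RHS](bigID (fun q => q \in primes w)) /= [X in (_ + X)%N]big1 ?addn0; last first.
  by move=> q; rewrite -logn_gt0 -leqNgt leqn0 => /eqP.
rewrite -[RHS]big_filter; apply: perm_big; apply: uniq_perm.
- exact: primes_uniq.
- by rewrite filter_uniq // uniq_primes_upto.
move=> q; rewrite mem_filter mem_primes_upto mem_primes w0 /=.
case: (prime q) => //=; case: (boolP (q %| w)%N) => //= qw.
by rewrite (leq_trans (dvdn_leq w0 qw)).
Qed.

(** * The truncated convolution algebra as a monomial quotient *)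

Section Gamma.
Variable K : fieldType.
Hypothesis n0 : (0 < n)%N.
Local Notation Gam := (Gam n K).

(** Values w > n are allowed and give 0, so the product rule for indicators needs no case
    distinction on the truncation. *)
Definition dG (w : nat) : Gam := [ffun m : 'I_n => ((m.+1 == w)%:R : K)].

Lemma mulG_linl (c : K) (f g h : Gam) : mulG (c *: f + g) h = c *: mulG f h + mulG g h.
Proof.
apply/ffunP => m; rewrite !ffunE /= scaler_sumr -big_split; apply: eq_bigr => x _ /=.
rewrite scaler_sumr -big_split; apply: eq_bigr => y _ /=.
by rewrite !ffunE /= mulrDl -!mulrA.
Qed.

Lemma mulG_linr (c : K) (f g h : Gam) : mulG f (c *: g + h) = c *: mulG f g + mulG f h.
Proof.
apply/ffunP => m; rewrite !ffunE /= scaler_sumr -big_split; apply: eq_bigr => x _ /=.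
rewrite scaler_sumr -big_split; apply: eq_bigr => y _ /=.
by rewrite !ffunE /= mulrDr mulrCA.
Qed.

Lemma mulG0l (f : Gam) : mulG 0 f = 0.
Proof.
apply/ffunP => m; rewrite !ffunE big1 // => x _; apply: big1 => y _.
by rewrite !ffunE mul0r.
Qed.

Lemma mulG0r (f : Gam) : mulG f 0 = 0.
Proof.
apply/ffunP => m; rewrite !ffunE big1 // => x _; apply: big1 => y _.
by rewrite !ffunE mulr0.
Qed.

Lemma mulG_dG (a b : nat) : (0 < a)%N -> (0 < b)%N -> mulG (dG a) (dG b) = dG (a * b)%N.
Proof.
move=> a0 b0; apply/ffunP => m; rewrite !ffunE.
have E (x y : 'I_n) : (dG a x : K) * (dG b y : K) = ((x.+1 == a) && (y.+1 == b))%:R.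
  by rewrite !ffunE -natrM mulnb.
under eq_bigr do under eq_bigr do rewrite E.
case: (boolP (m.+1 == a * b)%N) => [/eqP mab|mab]; last first.
  rewrite big1 // => x _; apply: big1 => y /eqP xy.
  case: (boolP (_ && _)) => //= /andP [/eqP xa /eqP yb].
  by case/eqP: mab; rewrite -xy xa yb.
have an : (a.-1 < n)%N.
  have := ltn_ord m; rewrite prednK // => mn; apply: leq_trans mn.
  by rewrite mab leq_pmulr.
have bn : (b.-1 < n)%N.
  have := ltn_ord m; rewrite prednK // => mn; apply: leq_trans mn.
  by rewrite mab leq_pmull.
rewrite (bigD1 (Ordinal an)) //= [X in _ + X]big1 ?addr0; last first.
  move=> x xa; rewrite big1 // => y _; case: (boolP (_ && _)) => //= /andP [/eqP xa' _].
  by case/eqP: xa; apply: val_inj; rewrite /= -xa'.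
rewrite (bigD1 (Ordinal bn)) /= ?prednK ?mab // !eqxx /= [X in _ + X]big1 ?addr0 //.
move=> y /andP [_ yb]; case: (boolP (_ == b)) => //= /eqP yb'.
by case/eqP: yb; apply: val_inj; rewrite /= -yb'.
Qed.

(** Reading off coefficients, rather than evaluating at the [chiG], makes linearity and the kernel
    immediate; multiplicativity is then checked on monomials. *)
Definition psi (p : {mpoly K[r]}) : Gam := [ffun m : 'I_n => (p@_(expv m.+1) : K)].

Lemma psi_lin (c : K) (p q : {mpoly K[r]}) : psi (c *: p + q) = c *: psi p + psi q.
Proof. by apply/ffunP => m; rewrite !ffunE mcoeffD mcoeffZ. Qed.

Lemma psi0 : psi 0 = 0.
Proof. by apply/ffunP => m; rewrite !ffunE mcoeff0. Qed.

Lemma psiX a : psi 'X_[a] = dG (mval a).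
Proof.
apply/ffunP => m; rewrite !ffunE mcoeffX; congr (_%:R); congr nat_of_bool.
apply/eqP/eqP => [->|->]; last by rewrite mvalK.
by rewrite expvK // ltn_ord.
Qed.

Lemma psiM p q : psi (p * q) = mulG (psi p) (psi q).
Proof.
elim/mpolyind: p => [|c a p _ _ IHp]; first by rewrite mul0r psi0 mulG0l.
rewrite mulrDl -scalerAl !psi_lin IHp mulG_linl; congr (_ *: _ + _).
elim/mpolyind: q {p IHp} => [|d b q _ _ IHq]; first by rewrite mulr0 psi0 mulG0r.
rewrite mulrDr -scalerAr !psi_lin IHq mulG_linr; congr (_ *: _ + _).
by rewrite -mpolyXD !psiX mvalD mulG_dG ?mval_gt0.
Qed.

Lemma oneGE : oneG n K = dG 1.
Proof. by apply/ffunP => m; rewrite !ffunE. Qed.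

Lemma chiGE j : chiG K j = dG (pr j).
Proof. by []. Qed.

Lemma psi1 : psi 1 = oneG n K.
Proof. by rewrite -mpolyX0 psiX mval0 oneGE. Qed.

Lemma psi_surj f : exists p, psi p = f.
Proof.
exists (\sum_(m < n) f m *: 'X_[expv m.+1]).
apply/ffunP => m; rewrite ffunE raddf_sum /= (bigD1 m) //= mcoeffZ mcoeffX eqxx mulr1.
rewrite big1 ?addr0 // => i im; rewrite mcoeffZ mcoeffX (_ : (_ == _) = false) ?mulr0 //.
apply: contraNF im => /eqP /(congr1 (@mval n)).
by rewrite !expvK ?ltn_ord // => -[/val_inj ->].
Qed.

Lemma dG_eq0 w : (n < w)%N -> dG w = 0.
Proof.
move=> nw; apply/ffunP => m; rewrite !ffunE (_ : (_ == w) = false) //.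
by apply/negbTE; rewrite neq_ltn (leq_trans _ nw) // ltnS ltn_ord.
Qed.

Lemma psi_ker p : psi p = 0 <-> inI p.
Proof.
split=> [p0|[s [sn ->]]].
  exists [seq ((p@_m)%:MP, m) | m <- msupp p]; split; last first.
    by rewrite big_map {1}[p]mpolyE; apply: eq_bigr => m _; rewrite mul_mpolyC.
  rewrite all_map; apply/allP => m mp /=; rewrite ltnNge; apply/negP => mn.
  have mn' : ((mval m).-1 < n)%N by rewrite prednK // mval_gt0.
  have /ffunP/(_ (Ordinal mn')) := p0; rewrite !ffunE /= prednK ?mval_gt0 // mvalK => /eqP.
  by rewrite mcoeff_eq0 mp.
elim: s sn => [_|[g m] s IH /= /andP [nm /IH sn]]; first by rewrite big_nil psi0.
by rewrite big_cons -[_ * _]scale1r psi_lin sn addr0 scale1r psiM psiX dG_eq0 // mulG0r.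
Qed.

Lemma inI_X m : inI ('X_[m] : {mpoly K[r]}) <-> (n < mval m)%N.
Proof.
rewrite -psi_ker psiX; split=> [/ffunP m0|/dG_eq0 //].
rewrite ltnNge; apply/negP => mn.
have mn' : ((mval m).-1 < n)%N by rewrite prednK // mval_gt0.
have := m0 (Ordinal mn'); rewrite !ffunE /= prednK ?mval_gt0 // eqxx => /eqP.
by rewrite oner_eq0.
Qed.

Lemma inI_stable m (j i : 'I_r) : (j <= i)%N ->
  inI ('X_j * 'X_[m] : {mpoly K[r]}) -> inI ('X_i * 'X_[m] : {mpoly K[r]}).
Proof.
move=> ji; rewrite -!mpolyXD !inI_X !mvalD !mvalU => /leq_trans; apply.
by rewrite leq_mul2r pr_leq ?orbT.
Qed.

Lemma artinian : artinianG n K.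
Proof.
move=> f _ fS.
have mono k l : (k <= l)%N -> (f l <= f k)%VS.
  move=> /subnK <-; elim: (l - k)%N => [|d IH]; first exact: subvv.
  by rewrite addSn; apply: subv_trans (fS _) IH.
(* Some term has least dimension; otherwise the dimension could drop below that of [f 0] arbitrarily
   often. *)
have [N HN] : exists N, forall k, (\dim (f N) <= \dim (f k))%N.
  apply: Classical_Prop.NNPP => H.
  suff : forall d, exists N, (\dim (f N) + d <= \dim (f 0%N))%N.
    by case/(_ (\dim (f 0%N)).+1) => N; rewrite addnS ltnNge leq_addl.
  elim=> [|d [N IH]]; first by exists 0%N; rewrite addn0.
  apply: Classical_Prop.NNPP => H'; apply: H; exists N => k.
  rewrite leqNgt; apply/negP => kN; apply: H'; exists k.
  by rewrite addnS -addSn (leq_trans _ IH) // leq_add2r.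
exists N => k Nk; apply/eqP; rewrite eqEdim mono //; exact: HN.
Qed.

Lemma dim_Gam : \dim (fullv : {vspace Gam}) = n.
Proof. by rewrite dimvf /dim /= card_ord muln1. Qed.

Lemma chiprodE s : chiprod K s = dG (mval (s2m s)).
Proof.
elim: s => [|j s IH] /=.
  have -> : s2m [::] = 0%MM :> 'X_{1..r} by apply/mnmP => i; rewrite !mnmE.
  by rewrite mval0 oneGE.
rewrite IH chiGE mulG_dG ?pr_gt0 ?mval_gt0 // -mvalU -mvalD.
have -> // : s2m (j :: s) = (U_(j) + s2m s)%MM.
by apply/mnmP => i; rewrite mnmDE mnm1E !mnmE /= eq_sym.
Qed.

Lemma mdeg_s2m (s : seq 'I_r) : mdeg (s2m s) = size s.
Proof.
elim: s => [|j s IH].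
  by rewrite mdegE big1 // => i _; rewrite mnmE.
have -> : s2m (j :: s) = (U_(j) + s2m s)%MM.
  by apply/mnmP => i; rewrite mnmDE mnm1E !mnmE /= eq_sym.
by rewrite mdegD mdeg1 IH.
Qed.

(** A product of i of the [chiG] is the indicator of an integer w with lambda w = i, or 0 if w > n.
    The indicators of distinct w at most n are independent. *)
Lemma dim_Gdeg i : \dim (Gdeg n K i) = #|[set w : 'I_n | lambda w.+1 == i]|.
Proof.
set S := [set w | _]; pose X := [tuple of [seq dG (w : 'I_n).+1 | w <- enum S]].
have -> : Gdeg n K i = <<X>>%VS.
  apply/eqP; rewrite eqEsubv; apply/andP; split; apply/span_subvP => x /mapP.
    case=> t _ ->; rewrite chiprodE.
    case: (leqP (mval (s2m t)) n) => [tn|/dG_eq0 ->]; last exact: mem0v.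
    have t0 := mval_gt0 (s2m t).
    have tn' : ((mval (s2m t)).-1 < n)%N by rewrite prednK.
    apply: memv_span; apply/mapP; exists (Ordinal tn'); last by rewrite /= prednK.
    by rewrite mem_enum inE /= prednK // lambdaE ?t0 // mvalK mdeg_s2m size_tuple.
  case=> w; rewrite mem_enum inE => /eqP wi ->.
  have wn : (0 < w.+1 <= n)%N by rewrite ltn_ord.
  have st : size (m2s (expv w.+1)) == i by rewrite size_m2s -lambdaE ?wi.
  apply: memv_span; apply/mapP; exists (Tuple st); first by rewrite mem_enum.
  by rewrite chiprodE /= s2mK expvK.
suff /eqP -> : free X by rewrite size_map -cardE.
apply/freeP => k k0 j.
pose w i := nth (Ordinal n0) (enum S) i.
have kw : \sum_i k i *: dG (w i).+1 = 0.
  rewrite -[RHS]k0; apply: eq_bigr => i' _; congr (_ *: _); apply: esym.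
  by rewrite (nth_map (Ordinal n0)) // -cardE.
have {}kw : (\sum_i k i *: dG (w i).+1) (w j) = 0 by rewrite kw ffunE.
move: kw; rewrite sum_ffunE (bigD1 j) // ffunE ffunE eqxx big1 => [|i' i'j].
  by rewrite /= addr0 => /eqP; rewrite mulf_eq0 oner_eq0 orbF => /eqP.
rewrite ffunE ffunE (_ : (_ == _) = false) ?scaler0 //.
apply: contraNF i'j; rewrite eqSS => /eqP /val_inj /eqP.
by rewrite nth_uniq ?enum_uniq -?cardE // eq_sym => /eqP /val_inj ->.
Qed.
End Gamma.
End Exponents.

(** * From logarithms to inequalities between integers *)

Section LogInequality.
Local Notation INR := Raxioms.INR.
Local Notation IZR := Rdefinitions.IZR.
Local Notation Rplus := Rdefinitions.Rplus.
Local Notation Rminus := Rdefinitions.Rminus.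
Local Notation Rmult := Rdefinitions.Rmult.
Local Notation Rlt := Rdefinitions.Rlt.
Local Notation Rle := Rdefinitions.Rle.
Local Notation lnN m := (Rpower.ln (INR m)).

Lemma INR_gt0 (m : nat) : (0 < m)%N -> Rlt (IZR BinNums.Z0) (INR m).
Proof. by move=> m0; apply: RIneq.lt_0_INR; apply/ssrnat.ltP. Qed.

Lemma lnNM (a b : nat) : (0 < a)%N -> (0 < b)%N ->
  lnN (a * b)%N = Rplus (lnN a) (lnN b).
Proof. by move=> a0 b0; rewrite -multE RIneq.mult_INR Rpower.ln_mult //; apply: INR_gt0. Qed.

Lemma lnNX (a k : nat) : (0 < a)%N -> lnN (a ^ k)%N = Rmult (INR k) (lnN a).
Proof.
move=> a0; elim: k => [|k IH]; first by rewrite Rpower.ln_1 RIneq.Rmult_0_l.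
rewrite expnS lnNM ?expn_gt0 ?a0 // IH RIneq.S_INR RIneq.Rmult_plus_distr_r Raxioms.Rmult_1_l.
exact: Raxioms.Rplus_comm.
Qed.

Lemma lnN_lt (a b : nat) : (0 < a)%N -> (0 < b)%N -> Rlt (lnN a) (lnN b) <-> (a < b)%N.
Proof.
move=> a0 b0; split=> ab.
  by apply/ssrnat.ltP; apply: RIneq.INR_lt; apply: Rpower.ln_lt_inv ab; apply: INR_gt0.
by apply: Rpower.ln_increasing; [exact: INR_gt0 | apply: RIneq.lt_INR; apply/ssrnat.ltP].
Qed.

Lemma lnN_le (a b : nat) : (0 < a)%N -> (0 < b)%N -> Rle (lnN a) (lnN b) <-> (a <= b)%N.
Proof.
move=> a0 b0; split=> ab.
  rewrite leqNgt; apply/negP => ba.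
  by apply: (RIneq.Rlt_not_le _ _ _ ab); apply/lnN_lt.
apply: RIneq.Rnot_lt_le => h; have := (lnN_lt b0 a0).1 h.
by rewrite ltnNge ab.
Qed.

(** The sum is the logarithm of [mval b], because the factors with j < v are 1; monotonicity of the
    logarithm does the rest. *)
Lemma solIneqP n (v : 'I_(rr n)) (b : 'X_{1..rr n}) : (0 < n)%N ->
  solIneq v b <-> [/\ forall j : 'I_(rr n), (j < v)%N -> b j = 0%N,
                      (n < pr n v * mval b)%N & (mval b <= n)%N].
Proof.
move=> n0; have m0 := mval_gt0 b; have p0 := pr_gt0 v.
have sumE : (forall j : 'I_(rr n), (j < v)%N -> b j = 0%N) ->
  \big[Rplus/IZR BinNums.Z0]_(j < rr n | (v <= j)%N) Rmult (INR (b j)) (lnN (pr n j))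
    = lnN (mval b).
  move=> b0; rewrite /mval (bigID (fun j : 'I_(rr n) => v <= j)%N) /=.
  rewrite [X in (_ * X)%N]big1 ?muln1; last by move=> j; rewrite -ltnNge => /b0 ->.
  set P := (\prod_(_ < _ | _) _)%N.
  suff [] : \big[Rplus/IZR BinNums.Z0]_(j < rr n | (v <= j)%N)
      Rmult (INR (b j)) (lnN (pr n j)) = lnN P /\ (0 < P)%N by [].
  rewrite /P; elim/big_rec2: _ => [|j m s _ [-> s0]]; first by rewrite Rpower.ln_1.
  have pj : (0 < pr n j ^ b j)%N by rewrite expn_gt0 pr_gt0.
  by rewrite lnNM // lnNX ?pr_gt0 // muln_gt0 pj s0.
have ltE : Rlt (Rminus (lnN n) (lnN (pr n v))) (lnN (mval b)) <-> (n < pr n v * mval b)%N.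
  rewrite -lnN_lt // ?muln_gt0 ?p0 // lnNM //.
  split=> h.
    have := Raxioms.Rplus_lt_compat_l (lnN (pr n v)) _ _ h.
    by rewrite RIneq.Rplus_minus.
  apply: (RIneq.Rplus_lt_reg_l (lnN (pr n v))); by rewrite RIneq.Rplus_minus.
split=> [[b0 /= []]|[b0 h1 h2]].
  by rewrite sumE // => /ltE h1 /lnN_le h2; split=> //; apply: h2.
by split=> //=; rewrite sumE //; split; [exact/ltE | apply/lnN_le].
Qed.
End LogInequality.

(** * Minimal generators, solutions and socle letters *)

Section Generators.
Variables (n : nat) (K : fieldType).
Hypothesis n0 : (0 < n)%N.
Local Notation r := (rr n).

(** Division by x_v gives a proper divisor of the generator, so its value is at most n, while p_v
    times it exceeds n. *)
Lemma minGen_sub (m : 'X_{1..r}) (v : 'I_r) : minGen K m -> minIs m v ->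
  solIneq v (m - U_(v))%MM.
Proof.
move=> [/inI_X nm mmin] [mv mj].
have Um : (U_(v) <= m)%MM.
  by apply/mnm_lepP => i; rewrite mnm1E; case: eqP => // <-.
have Em : mval m = (pr n v * mval (m - U_(v))%MM)%N.
  by rewrite mulnC -mvalU -mvalD submK.
apply/solIneqP => //; split.
- by move=> j jv; rewrite mnmBE mj.
- by rewrite -Em.
- rewrite leqNgt; apply/negP => /(inI_X K); apply: mmin.
    by move=> i; rewrite mnmBE leq_subr.
  by move/(congr1 (@mval n)) => /eqP; rewrite Em -{1}[mval _]mul1n eqn_pmul2r ?mval_gt0 //;
    rewrite ltn_eqF // prime_gt1 // pr_prime.
Qed.

(** A proper divisor m' of b x_v misses some factor x_i, where i >= v since b x_v involves no
    smaller variable. From p_v <= p_i and m' x_i dividing b x_v, the value of m' is at most that of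
    b, hence at most n. *)
Lemma minGen_add (b : 'X_{1..r}) (v : 'I_r) : solIneq v b ->
  minGen K (b + U_(v))%MM /\ minIs (b + U_(v))%MM v.
Proof.
move/(solIneqP _ _ n0) => [bj h1 h2]; split; last first.
  split; first by rewrite mnmDE mnm1E eqxx addn1.
  move=> j jv; rewrite mnmDE mnm1E bj // (_ : (v == j) = false) //.
  by apply/negbTE; apply: contraTneq jv => ->; rewrite ltnn.
split; first by apply/inI_X; rewrite // mvalD mvalU mulnC.
move=> m' le' ne' /inI_X; apply/negP; rewrite -leqNgt.
have [i im] : exists i, (m' i < (b + U_(v))%MM i)%N.
  apply/existsP; rewrite -[[exists _, _]]negbK negb_exists; apply/negP => /forallP h.
  apply: ne'; apply/mnmP => i; apply/eqP; rewrite eqn_leq le' /=.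
  by have := h i; rewrite -leqNgt.
have vi : (v <= i)%N.
  rewrite leqNgt; apply/negP => iv; move: im; rewrite mnmDE mnm1E bj //.
  have -> // : (v == i) = false.
  by apply/negbTE; apply: contraTneq iv => ->; rewrite ltnn.
have : (mval (m' + U_(i))%MM <= mval (b + U_(v))%MM)%N.
  apply: mval_le => k; rewrite mnmDE [U_(i)%MM k]mnm1E.
  by case: eqP => [<-|_]; rewrite ?addn1 ?addn0.
rewrite !mvalD !mvalU => h.
have pv := pr_leq vi (ltn_ord i).
have : (mval m' * pr n v <= mval b * pr n v)%N.
  by apply: leq_trans h; rewrite leq_mul2l pv orbT.
by rewrite leq_pmul2r ?pr_gt0 // => /leq_trans; apply.
Qed.

Lemma generators_bijection (v : 'I_r) :
  exists (f g : 'X_{1..r} -> 'X_{1..r}),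
    (forall m, minGen K m -> minIs m v -> solIneq v (f m)) /\
    (forall b, solIneq v b -> minGen K (g b) /\ minIs (g b) v) /\
    (forall m, minGen K m -> minIs m v -> g (f m) = m) /\
    (forall b, solIneq v b -> f (g b) = b).
Proof.
exists (fun m => m - U_(v))%MM, (fun b => b + U_(v))%MM; split.
  by move=> m; apply: minGen_sub.
split; first by move=> b; apply: minGen_add.
split=> [m _ [mv _]|b _]; last by rewrite addmK.
by rewrite submK //; apply/mnm_lepP => i; rewrite mnm1E; case: eqP => // <-.
Qed.

(** Identifies the solution count C_{n,v} with the size of the socle, the constant produced by the
    bar computation. *)
Lemma socle_solutions (v : 'I_r) :
  exists e : 'I_(size (socle_letters n v)) -> 'X_{1..r},
    injective e /\ (forall k, solIneq v (e k)) /\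
    (forall b, solIneq v b -> exists k, e k = b).
Proof.
have sP s : s \in socle_letters n v ->
    [/\ (0 < s <= n)%N, forall j : 'I_r, (j < v)%N -> expv n s j = 0%N
      & (n < pr n v * s)%N].
  rewrite mem_filter => /andP [ns /mem_letters [s1 sn sj]].
  split=> //; first by rewrite sn ltnW.
  move=> j jv; rewrite mnmE; apply/eqP; rewrite -leqn0 leqNgt logn_gt0 mem_primes.
  by rewrite (negbTE (sj j jv)) !andbF.
have kP (k : 'I_(size (socle_letters n v))) := sP _ (mem_nth 0%N (ltn_ord k)).
exists (fun k => expv n (nth 0%N (socle_letters n v) k)); split.
  move=> k l /(congr1 (@mval n)).
  have [hk _ _] := kP k; have [hl _ _] := kP l; rewrite !expvK // => /eqP.
  rewrite nth_uniq // => [/eqP /val_inj //|].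
  by apply: filter_uniq; apply: letters_uniq.
split=> [k|b /(solIneqP _ _ n0) [bj h1 h2]].
  by have [hk hj hn] := kP k; apply/solIneqP => //; rewrite expvK //; case/andP: hk.
have bs : mval b \in socle_letters n v.
  rewrite mem_filter h1; apply/mem_letters; split=> //.
    (* The exponent vector 0 is not a solution: it would require n < p_v. *)
    rewrite ltn_neqAle mval_gt0 andbT; apply/eqP => b1.
    by move: h1; rewrite -b1 muln1 ltnNge pr_le.
  move=> j jv; have jr := ltn_trans jv (ltn_ord v).
  have := bj (Ordinal jr) jv; rewrite -{1}(mvalK b) mnmE /= => /eqP.
  rewrite -leqn0 leqNgt logn_gt0 mem_primes mval_gt0 pr_prime //=.
have kl : (index (mval b) (socle_letters n v) < size (socle_letters n v))%N.
  by rewrite index_mem.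
by exists (Ordinal kl); rewrite /= nth_index // mvalK.
Qed.
End Generators.

Unset Implicit Arguments.

Theorem mainTheorem1 (K : fieldType) (n : nat) :
  [pchar K] =i pred0 -> (0 < n)%N ->
  (* (I) Gamma_n ~ K[x_1..x_r]/I_n via x_j |-> chi_j *)
  (exists psi : {mpoly K[rr n]} -> Gam n K,
      (forall (a : K) (p q : {mpoly K[rr n]}), psi (a *: p + q) = a *: psi p + psi q) /\
      (forall p q, psi (p * q) = mulG (psi p) (psi q)) /\
      psi 1 = oneG n K /\
      (forall j, psi 'X_j = chiG K j) /\
      (forall f : Gam n K, exists p, psi p = f) /\
      (forall p, psi p = 0 <-> inI p)) /\
  (* (I) I_n strongly stable w.r.t. the reverse order of the variables *)
  (forall (m : 'X_{1..rr n}) (j i : 'I_(rr n)), (j <= i)%N ->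
      inI ('X_j * 'X_[m] : {mpoly K[rr n]}) -> inI ('X_i * 'X_[m] : {mpoly K[rr n]})) /\
  (* (II) artinian, dimension n, Hilbert series *)
  artinianG n K /\
  \dim (fullv : {vspace Gam n K}) = n /\
  (forall i : nat, \dim (Gdeg n K i) = #|[set w : 'I_n | lambda w.+1 == i]|) /\
  (* (III) bijection between minimal generators with min = v and solutions *)
  (forall v : 'I_(rr n),
     exists (f g : 'X_{1..rr n} -> 'X_{1..rr n}),
       (forall m, minGen K m -> minIs m v -> solIneq v (f m)) /\
       (forall b, solIneq v b -> minGen K (g b) /\ minIs (g b) v) /\
       (forall m, minGen K m -> minIs m v -> g (f m) = m) /\
       (forall b, solIneq v b -> f (g b) = b)) /\
  (* (IV) Poincare-Betti series, with C v = C_{n,v+1} = number of solutions *)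
  (exists C : 'I_(rr n) -> nat,
     (forall v, exists e : 'I_(C v) -> 'X_{1..rr n},
         injective e /\ (forall k, solIneq v (e k)) /\
         (forall b, solIneq v b -> exists k, e k = b)) /\
     let D : {poly int} :=
       1 - 'X ^+ 2 * \sum_(k < rr n) ((1 + 'X) ^+ k * ((C (rev_ord k))%:R)%:P) in
     forall q : nat,
       \sum_(k < q.+1) (TorGam n K k)%:R * D`_(q - k) = ('C(rr n, q))%:R :> int).
Proof.
move=> _ n0; split.
  exists (@psi n K); split; first exact: psi_lin.
  split; first exact: psiM.
  split; first exact: psi1.
  split; first by move=> j; rewrite psiX // mvalU.
  by split; [exact: psi_surj | exact: psi_ker].
split; first exact: inI_stable.
split; first exact: artinian.
split; first exact: dim_Gam.
split; first exact: dim_Gdeg.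
split; first exact: generators_bijection.
(* As [rev_ord k] is r - (k + 1), the socle sizes occur in the order in which [letters_splitting]
   adjoins the primes. *)
exists (fun v => size (socle_letters n v)); split; first exact: socle_solutions.
have [H [E [sp ser]]] :=
  letters_splitting (free_algebra_exists K) (leqnn (rr n)).
rewrite subnn letters_from0 in sp => D q.
rewrite -ser; apply: eq_bigr => k _; congr (_%:R * _).
exact: TorGam_splitting sp k.
Qed.
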